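(* Let $R$ be a ring, $M$ an $R$-$R$-bimodule, $R\ltimes M$ the trivial ring extension, $n\geqslant 1$ an integer, and $\mathcal{C},\mathcal{D}$ classes of left $R$-modules. (1) Let $(\mathcal{C},\mathcal{D})$ be a left $n$-cotorsion pair in $R$-$\mathrm{Mod}$. Assume that $\mathrm{Ext}_R^i(M,D)=0$ and $\mathrm{Ext}_R^1(\mathrm{Hom}_R(M,F),F)=0$ for each $1\leqslant i\leqslant n$, any $D\in\mathcal{D}$ and any $F\in\mathcal{D}_{n-1}^{\wedge}$, that $\mathfrak{U}^{\mathcal{C}}$ is a resolving class, and that $(\mathfrak{J}^{\mathcal{D}})_{n-1}^{\wedge}$ is closed under extensions. Then $(\mathfrak{U}^{\mathcal{C}},\mathfrak{J}^{\mathcal{D}})$ is a left $n$-cotorsion pair in $R\ltimes M$-$\mathrm{Mod}$. (2) Let $(\mathcal{C},\mathcal{D})$ be a right $n$-cotorsion pair in $R$-$\mathrm{Mod}$. Assume that $\mathrm{Tor}_i^R(M,C)=0$ and $\mathrm{Ext}_R^1(E,M\otimes_R E)=0$ for each $1\leqslant i\leqslant n$, any $C\in\mathcal{C}$ and any $E\in\mathcal{C}_{n-1}^{\vee}$, that $\mathfrak{U}^{\mathcal{D}}$ is a coresolving class, and that $(\mathfrak{B}^{\mathcal{C}})_{n-1}^{\vee}$ is closed under extensions. Then $(\mathfrak{B}^{\mathcal{C}},\mathfrak{U}^{\mathcal{D}})$ is a right $n$-cotorsion pair in $R\ltimes M$-$\mathrm{Mod}$.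
   Context: Rings are associative with identity, modules are unitary, and $S$-$\mathrm{Mod}$ is the category of left $S$-modules. Classes of modules contain $0$ and are closed under isomorphisms. The trivial ring extension $R\ltimes M$ is $R\times M$ with componentwise addition and $(r_1,m_1)(r_2,m_2)=(r_1r_2,r_1m_2+m_1r_2)$. A left $R\ltimes M$-module is identified with a pair $(X,\alpha)$, where $X$ is a left $R$-module and $\alpha:M\otimes_R X\to X$ is $R$-linear with $\alpha\circ(M\otimes_R\alpha)=0$; equivalently (by adjunction) with a pair $[Y,\beta]$, where $Y$ is a left $R$-module and $\beta:Y\to\mathrm{Hom}_R(M,Y)$ is $R$-linear with $\mathrm{Hom}_R(M,\beta)\circ\beta=0$. Morphisms are $R$-linear maps compatible with the structure maps; a sequence is exact iff the underlying sequence of $R$-modules is exact. For a class $\mathcal{C}$ of left $R$-modules: $\mathfrak{U}^{\mathcal{C}}$ is the class of $R\ltimes M$-modules $(X,\alpha)$ with $X\in\mathcal{C}$ (equivalently $[Y,\beta]$ with $Y\in\mathcal{C}$); $\mathfrak{B}^{\mathcal{C}}$ is the class of $(X,\alpha)$ with $\mathrm{Coker}\,\alpha\in\mathcal{C}$ and $M\otimes_R M\otimes_R X\xrightarrow{M\otimes_R\alpha}M\otimes_R X\xrightarrow{\alpha}X$ exact; $\mathfrak{J}^{\mathcal{C}}$ is the class of $[Y,\beta]$ with $\mathrm{Ker}\,\beta\in\mathcal{C}$ and $Y\xrightarrow{\beta}\mathrm{Hom}_R(M,Y)\xrightarrow{\mathrm{Hom}_R(M,\beta)}\mathrm{Hom}_R(M,\mathrm{Hom}_R(M,Y))$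 exact. A class is resolving (resp. coresolving) if it is closed under extensions and kernels of epimorphisms (resp. extensions and cokernels of monomorphisms). For a class $\mathcal{C}$ of objects of an abelian category and $m\geqslant 0$: $\mathcal{C}_m^{\wedge}$ is the class of objects $A$ admitting an exact sequence $0\to C_k\to\cdots\to C_0\to A\to 0$ with all $C_i\in\mathcal{C}$ and some $k\leqslant m$; $\mathcal{C}_m^{\vee}$ is the class of objects $A$ admitting an exact sequence $0\to A\to C^0\to\cdots\to C^k\to 0$ with all $C^i\in\mathcal{C}$ and some $k\leqslant m$. A pair $(\mathcal{C},\mathcal{D})$ of classes of objects in an abelian category is a left $n$-cotorsion pair if (i) $\mathcal{C}$ is closed under direct summands, (ii) $\mathrm{Ext}^i(C,D)=0$ for all $1\leqslant i\leqslant n$, $C\in\mathcal{C}$, $D\in\mathcal{D}$, and (iii) every object $A$ admits a short exact sequence $0\to K\to C\to A\to 0$ with $C\in\mathcal{C}$, $K\in\mathcal{D}_{n-1}^{\wedge}$. It is a right $n$-cotorsion pair if (i') $\mathcal{D}$ is closed under direct summands, (ii) holds, and (iii') every object $A$ admits a short exact sequence $0\to A\to D\to K\to 0$ with $D\in\mathcal{D}$, $K\in\mathcal{C}_{n-1}^{\vee}$. *)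

(* Defs.v *)
From HB Require Import structures.
From mathcomp Require Import all_boot all_algebra.
From mathcomp Require Import boolp.
From mathcomp.multinomials Require Import freeg.

Set Implicit Arguments.
Unset Strict Implicit.
Unset Printing Implicit Defensive.

Import GRing.Theory.
Local Open Scope ring_scope.
Local Open Scope quotient_scope.

(* Rings are [pzRingType]s, so that the zero ring is allowed. *)

Section KerCoker.
Variables (R : pzRingType) (A B : lmodType R) (f : {linear A -> B}).

Definition ker_mem : {pred A} := fun a => f a == 0.

Fact ker_mem_closed : submod_closed ker_mem.
Proof.
split=> [|r x y /eqP fx /eqP fy]; first by rewrite /in_mem /= /ker_mem raddf0.
by apply/eqP; rewrite linearP fx fy scaler0 addr0.
Qed.
HB.instance Definition _ := GRing.isSubmodClosed.Build R A ker_mem ker_mem_closed.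

Definition ker : Type := {a : A | a \in ker_mem}.
HB.instance Definition _ := [isSub of ker for @sval A _].
HB.instance Definition _ := [Choice of ker by <:].
HB.instance Definition _ := [SubChoice_isSubLmodule of ker by <:].

Definition to_ker (a : A) (fa : f a = 0) : ker :=
  exist (fun a => a \in ker_mem) a (introT eqP fa).

Lemma kerP (k : ker) : f (val k) = 0.
Proof. exact: eqP (valP k). Qed.

Definition range_mem : {pred B} := fun b => `[< exists a, f a = b >].

Fact range_mem_closed : submod_closed range_mem.
Proof.
split=> [|r _ _ /asboolP[a <-] /asboolP[b <-]]; apply/asboolP.
  by exists 0; rewrite raddf0.
by exists (r *: a + b); rewrite linearP.
Qed.
HB.instance Definition _ :=
  GRing.isSubmodClosed.Build R B range_mem range_mem_closed.

Definition coker : Type := Quotient.quot range_mem.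
HB.instance Definition _ := GRing.Zmodule.on coker.
HB.instance Definition _ := EqQuotient.on coker.

Definition to_coker (b : B) : coker := \pi_(Quotient.quot range_mem) b.

Lemma to_cokerP b b' : to_coker b = to_coker b' <-> exists a, f a = b - b'.
Proof.
split=> [/eqP|[a fa]].
  by rewrite /to_coker -Quotient.idealrBE => /asboolP.
by apply/eqP; rewrite /to_coker -Quotient.idealrBE; apply/asboolP; exists a.
Qed.

Lemma to_coker_surj c : exists b, to_coker b = c.
Proof. by exists (repr c); rewrite /to_coker reprK. Qed.

Lemma to_cokerD : {morph to_coker : x y / x + y}.
Proof. by move=> x y; rewrite /to_coker raddfD. Qed.

Definition coker_scale (r : R) (c : coker) : coker := to_coker (r *: repr c).

Lemma to_cokerZ r b : coker_scale r (to_coker b) = to_coker (r *: b).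
Proof.
apply/to_cokerP; have [a fa] : exists a, f a = repr (to_coker b) - b.
  by apply/to_cokerP; rewrite /to_coker reprK.
by exists (r *: a); rewrite linearZ /= fa scalerBr.
Qed.

Fact coker_scaleA a b v :
  coker_scale a (coker_scale b v) = coker_scale (a * b) v.
Proof. by have [x <-] := to_coker_surj v; rewrite !to_cokerZ scalerA. Qed.
Fact coker_scale1 : left_id 1 coker_scale.
Proof. by move=> v; have [x <-] := to_coker_surj v; rewrite to_cokerZ scale1r. Qed.
Fact coker_scaleDr : right_distributive coker_scale +%R.
Proof.
move=> a u v; have [x <-] := to_coker_surj u; have [y <-] := to_coker_surj v.
by rewrite -to_cokerD !to_cokerZ -to_cokerD scalerDr.
Qed.
Fact coker_scaleDl v : {morph coker_scale^~ v : a b / a + b}.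
Proof.
by move=> a b; have [x <-] := to_coker_surj v; rewrite !to_cokerZ -to_cokerD scalerDl.
Qed.
HB.instance Definition _ := GRing.Zmodule_isLmodule.Build R coker
  coker_scaleA coker_scale1 coker_scaleDr coker_scaleDl.

End KerCoker.

Definition surjective (A B : Type) (f : A -> B) := forall b, exists a, f a = b.

Definition exact (R : pzRingType) (A B C : lmodType R)
    (f : {linear A -> B}) (g : {linear B -> C}) :=
  forall b, g b = 0 <-> exists a, f a = b.

Definition short_exact (R : pzRingType) (A B C : lmodType R)
    (f : {linear A -> B}) (g : {linear B -> C}) :=
  [/\ injective f, exact f g & surjective g].

Record modclass (R : pzRingType) := Modclass {
  class_mem :> lmodType R -> Prop;
  class0 : forall A : lmodType R, (forall a : A, a = 0) -> class_mem A;
  class_iso : forall (A B : lmodType R) (f : {linear A -> B}),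
    bijective f -> class_mem A -> class_mem B
}.

Section Classes.
Variables (R : pzRingType) (C : lmodType R -> Prop).

Definition closed_extensions :=
  forall (A B E : lmodType R) (f : {linear A -> E}) (g : {linear E -> B}),
    short_exact f g -> C A -> C B -> C E.

Definition closed_ker_epi :=
  forall (A B E : lmodType R) (f : {linear A -> E}) (g : {linear E -> B}),
    short_exact f g -> C E -> C B -> C A.

Definition closed_coker_mono :=
  forall (A B E : lmodType R) (f : {linear A -> E}) (g : {linear E -> B}),
    short_exact f g -> C A -> C E -> C B.

Definition closed_summands := forall A B : lmodType R, C (A * B)%type -> C A.

Definition resolving := closed_extensions /\ closed_ker_epi.
Definition coresolving := closed_extensions /\ closed_coker_mono.

End Classes.

Record resolution (R : pzRingType) (A : lmodType R) := Resolution {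
  res_obj :> nat -> lmodType R;
  res_d : forall i, {linear res_obj i.+1 -> res_obj i};
  res_aug : {linear res_obj 0%N -> A};
  res_aug_surj : surjective res_aug;
  res_exact0 : exact (res_d 0%N) res_aug;
  res_exact : forall i, exact (res_d i.+1) (res_d i)
}.

Record coresolution (R : pzRingType) (A : lmodType R) := Coresolution {
  cores_obj :> nat -> lmodType R;
  cores_d : forall i, {linear cores_obj i -> cores_obj i.+1};
  cores_aug : {linear A -> cores_obj 0%N};
  cores_aug_inj : injective cores_aug;
  cores_exact0 : exact cores_aug (cores_d 0%N);
  cores_exact : forall i, exact (cores_d i) (cores_d i.+1)
}.

Section Wedge.
Variables (R : pzRingType) (C : lmodType R -> Prop) (m : nat).

(* A finite exact sequence 0 -> C_k -> ... -> C_0 -> A -> 0 is a resolution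
   that vanishes in degrees above k. *)
Definition wedge (A : lmodType R) : Prop :=
  exists (k : nat) (P : resolution A),
    [/\ (k <= m)%N,
        forall i, (i <= k)%N -> C (P i)
      & forall i, (k < i)%N -> forall x : P i, x = 0].

Definition vee (A : lmodType R) : Prop :=
  exists (k : nat) (Q : coresolution A),
    [/\ (k <= m)%N,
        forall i, (i <= k)%N -> C (Q i)
      & forall i, (k < i)%N -> forall x : Q i, x = 0].

End Wedge.

Definition projective (R : pzRingType) (P : lmodType R) :=
  forall (A B : lmodType R) (g : {linear A -> B}) (f : {linear P -> B}),
    surjective g -> exists h : {linear P -> A}, forall x, g (h x) = f x.

Section FreeModule.
Variables (R : pzRingType) (A : Type).

Inductive fterm : Type :=
  FZero | FVar of A | FOpp of fterm | FAdd of fterm & fterm | FScale of R & fterm.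
HB.instance Definition _ := gen_eqMixin fterm.
HB.instance Definition _ := gen_choiceMixin fterm.

Fixpoint feval (V : lmodType R) (f : A -> V) (t : fterm) : V :=
  match t with
  | FZero => 0
  | FVar a => f a
  | FOpp u => - feval f u
  | FAdd u v => feval f u + feval f v
  | FScale r u => r *: feval f u
  end.

Definition feq : rel fterm := fun t u =>
  `[< forall (V : lmodType R) (f : A -> V), feval f t = feval f u >].

Fact feq_equiv : equiv_class_of feq.
Proof.
split=> [t|t u|t u v /asboolP tu /asboolP uv]; first by apply/asboolP.
  by apply/asboolP/asboolP => h V f; rewrite h.
by apply/asboolP => V f; rewrite tu uv.
Qed.
Canonical feq_equivrel := EquivRelPack feq_equiv.
Canonical feq_encmod := defaultEncModRel feq.

Definition free_mod : Type := {eq_quot feq}.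
HB.instance Definition _ := Choice.on free_mod.

Definition fpi (t : fterm) : free_mod := \pi_{eq_quot feq} t.
Definition frep (x : free_mod) : fterm := repr (x : {eq_quot feq}).

Lemma fpiP t u :
  fpi t = fpi u <-> forall (V : lmodType R) (f : A -> V), feval f t = feval f u.
Proof.
split=> [/eqP|h]; last apply/eqP; rewrite /fpi ?eqmodE; first by move/asboolP.
exact/asboolP.
Qed.

Lemma frepK x : fpi (frep x) = x.
Proof. exact: reprK. Qed.

Lemma feval_rep (V : lmodType R) (f : A -> V) t : feval f (frep (fpi t)) = feval f t.
Proof. by move: V f; apply/fpiP; rewrite frepK. Qed.

Definition free_add x y := fpi (FAdd (frep x) (frep y)).
Definition free_opp x := fpi (FOpp (frep x)).
Definition free_scale r x := fpi (FScale r (frep x)).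

Fact free_addA : associative free_add.
Proof. by move=> x y z; apply/fpiP => V f /=; rewrite !feval_rep /= addrA. Qed.
Fact free_addC : commutative free_add.
Proof. by move=> x y; apply/fpiP => V f /=; rewrite addrC. Qed.
Fact free_add0 : left_id (fpi FZero) free_add.
Proof.
move=> x; rewrite -[RHS]frepK; apply/fpiP => V f /=.
by rewrite feval_rep /= add0r.
Qed.
Fact free_addN : left_inverse (fpi FZero) free_opp free_add.
Proof. by move=> x; apply/fpiP => V f /=; rewrite !feval_rep /= addNr. Qed.
HB.instance Definition _ :=
  GRing.isZmodule.Build free_mod free_addA free_addC free_add0 free_addN.

Fact free_scaleA a b x : free_scale a (free_scale b x) = free_scale (a * b) x.
Proof. by apply/fpiP => V f /=; rewrite !feval_rep /= scalerA. Qed.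
Fact free_scale1 : left_id 1 free_scale.
Proof. by move=> x; rewrite -[RHS]frepK; apply/fpiP => V f /=; rewrite scale1r. Qed.
Fact free_scaleDr : right_distributive free_scale +%R.
Proof. by move=> r x y; apply/fpiP => V f /=; rewrite !feval_rep /= scalerDr. Qed.
Fact free_scaleDl x : {morph free_scale^~ x : a b / a + b}.
Proof. by move=> a b; apply/fpiP => V f /=; rewrite !feval_rep /= scalerDl. Qed.
HB.instance Definition _ := GRing.Zmodule_isLmodule.Build R free_mod
  free_scaleA free_scale1 free_scaleDr free_scaleDl.

Definition free_var (a : A) : free_mod := fpi (FVar a).

Section Lift.
Variables (V : lmodType R) (f : A -> V).

Definition flift (x : free_mod) : V := feval f (frep x).

Lemma flift_var a : flift (free_var a) = f a.
Proof. exact: feval_rep. Qed.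

Fact flift_linear : linear flift.
Proof.
move=> r x y; rewrite /flift -[r *: x]/(free_scale r x) -[_ + y]/(free_add _ y).
by rewrite !feval_rep /= feval_rep.
Qed.
HB.instance Definition _ := GRing.isLinear.Build R free_mod V _ flift flift_linear.
End Lift.

Lemma flift_ext (V : lmodType R) (f g : {linear free_mod -> V}) :
  (forall a, f (free_var a) = g (free_var a)) -> f =1 g.
Proof.
move=> fg x; rewrite -[x]frepK; elim: (frep x) => [|a|t IH|t IHt u IHu|r t IH].
- by rewrite -[fpi FZero]/(0 : free_mod) !raddf0.
- exact: fg.
- have -> : fpi (FOpp t) = - fpi t.
    by apply/fpiP => V' f' /=; rewrite feval_rep.
  by rewrite !raddfN /= IH.
- have -> : fpi (FAdd t u) = fpi t + fpi u.
    by apply/fpiP => V' f' /=; rewrite !feval_rep.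
  by rewrite !raddfD /= IHt IHu.
- have -> : fpi (FScale r t) = r *: fpi t.
    by apply/fpiP => V' f' /=; rewrite feval_rep.
  by rewrite !linearZ /= IH.
Qed.

Lemma free_projective : projective free_mod.
Proof.
move=> B C g f g_surj.
have /choice[s sP] : forall a, exists b, g b = f (free_var a) by move=> a; apply: g_surj.
exists (flift s) => x.
by apply: (@flift_ext _ (g \o flift s) f) => a; rewrite /= flift_var.
Qed.

End FreeModule.

Section Resolve.
Variables (R : pzRingType) (A : lmodType R).

Definition cover (B : lmodType R) : {linear free_mod R B -> B} := flift (id : B -> B).

Lemma cover_surj B : surjective (cover B).
Proof. by move=> b; exists (free_var R b); apply: flift_var. Qed.

Fixpoint syzygy (i : nat) : lmodType R :=
  if i is j.+1 then ker (cover (syzygy j)) else A.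

Definition std_obj (i : nat) : lmodType R := free_mod R (syzygy i).
Definition std_d (i : nat) : {linear std_obj i.+1 -> std_obj i} :=
  (\val : ker (cover (syzygy i)) -> std_obj i) \o cover (syzygy i.+1).

Lemma std_d_ker i x : cover (syzygy i) x = 0 <-> exists y, std_d i y = x.
Proof.
split=> [x0|[y <-]]; last exact: (eqP (svalP (cover (syzygy i.+1) y))).
have kx : x \in ker_mem (cover (syzygy i)) by apply/eqP.
have [y yx] := @cover_surj (syzygy i.+1) (exist _ x kx).
by exists y; rewrite /= yx.
Qed.

Lemma std_d_exact i : exact (std_d i.+1) (std_d i).
Proof.
move=> x; rewrite -std_d_ker; split=> [h|h]; first exact: val_inj.
by rewrite /std_d /= h.
Qed.

Definition std_resolution : resolution A :=
  @Resolution R A std_obj std_d (cover A) (@cover_surj A)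
    (@std_d_ker 0%N) std_d_exact.

End Resolve.

Theorem projective_resolution_exists (R : pzRingType) (A : lmodType R) :
  exists P : resolution A, forall j, projective (P j).
Proof. by exists (std_resolution A) => j; apply: free_projective. Qed.

(* Ext^i(A, B) is the i-th cohomology of Hom(P, B), for P a projective
   resolution of A; such a P exists by [projective_resolution_exists]. *)
Definition Ext_zero (R : pzRingType) (i : nat) (A B : lmodType R) : Prop :=
  forall P : resolution A, (forall j, projective (P j)) ->
    match i with
    | 0%N => forall f : {linear P 0%N -> B},
        (forall x, f (res_d P 0%N x) = 0) -> forall x, f x = 0
    | j.+1 => forall f : {linear P j.+1 -> B},
        (forall x, f (res_d P j.+1 x) = 0) ->
        exists g : {linear P j -> B}, forall x, f x = g (res_d P j x)
    end.

Record left_cotorsion_pair (R : pzRingType) (n : nat) (C D : modclass R) : Prop :=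
  LeftCotorsionPair {
  lcp_summands : closed_summands C;
  lcp_Ext : forall i (A B : lmodType R),
    (1 <= i <= n)%N -> C A -> D B -> Ext_zero i A B;
  lcp_approx : forall A : lmodType R,
    exists (K E : lmodType R) (f : {linear K -> E}) (g : {linear E -> A}),
      [/\ short_exact f g, C E & wedge D n.-1 K]
}.

Record right_cotorsion_pair (R : pzRingType) (n : nat) (C D : modclass R) : Prop :=
  RightCotorsionPair {
  rcp_summands : closed_summands D;
  rcp_Ext : forall i (A B : lmodType R),
    (1 <= i <= n)%N -> C A -> D B -> Ext_zero i A B;
  rcp_approx : forall A : lmodType R,
    exists (E K : lmodType R) (f : {linear A -> E}) (g : {linear E -> K}),
      [/\ short_exact f g, D E & vee C n.-1 K]
}.

Record bimod (R : pzRingType) := Bimod {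
  bimod_left :> lmodType R;
  rscale : bimod_left -> R -> bimod_left;
  rscaleDl : forall m m' r, rscale (m + m') r = rscale m r + rscale m' r;
  rscaleDr : forall m r r', rscale m (r + r') = rscale m r + rscale m r';
  rscale1 : forall m, rscale m 1 = m;
  rscaleA : forall m r r', rscale m (r * r') = rscale (rscale m r) r';
  rscale_scale : forall r m r', r *: rscale m r' = rscale (r *: m) r'
}.

Lemma rscale0l (R : pzRingType) (M : bimod R) r : rscale (0 : M) r = 0.
Proof. by apply: (addrI (rscale 0 r)); rewrite -rscaleDl !addr0. Qed.

Lemma rscale0r (R : pzRingType) (M : bimod R) (m : M) : rscale m 0 = 0.
Proof. by apply: (addrI (rscale m 0)); rewrite -rscaleDr !addr0. Qed.

Section Tensor.
Variables (R : pzRingType) (M : bimod R) (X : lmodType R).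

Local Notation F := {freeg (M * X)%type / int}.
Local Notation "m |*| x" := (<< (m, x) >> : F) (at level 40).

Variant tens_rel : F -> Prop :=
| TensDl m m' x : tens_rel ((m + m') |*| x - m |*| x - m' |*| x)
| TensDr m x x' : tens_rel (m |*| (x + x') - m |*| x - m |*| x')
| TensBal m r x : tens_rel (rscale m r |*| x - m |*| (r *: x)).

(* M (x)_R X is the free abelian group F on M x X modulo the subgroup generated
   by the relations [tens_rel]. *)
Definition tens_null : {pred F} := fun d =>
  `[< forall N : zmodClosed F, (forall e, tens_rel e -> e \in N) -> d \in N >].

Fact tens_null_closed : zmod_closed tens_null.
Proof.
split=> [|d e /asboolP dN /asboolP eN]; apply/asboolP => N relN.
  exact: rpred0.
by rewrite rpredB ?dN ?eN.
Qed.
HB.instance Definition _ := GRing.isZmodClosed.Build F tens_null tens_null_closed.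

Definition tens : Type := Quotient.quot tens_null.
HB.instance Definition _ := GRing.Zmodule.on tens.

Definition to_tens (d : F) : tens := \pi_(Quotient.quot tens_null) d.
Definition tensor (m : M) (x : X) : tens := to_tens (m |*| x).

Lemma to_tens0 : to_tens 0 = 0.
Proof. by rewrite /to_tens raddf0. Qed.
Lemma to_tensD : {morph to_tens : d e / d + e}.
Proof. by move=> d e; rewrite /to_tens raddfD. Qed.
Lemma to_tensB : {morph to_tens : d e / d - e}.
Proof. by move=> d e; rewrite /to_tens raddfB. Qed.

Lemma to_tensP d e : to_tens d = to_tens e <-> d - e \in tens_null.
Proof.
by split=> [/eqP|h]; last apply/eqP; rewrite /to_tens -Quotient.idealrBE.
Qed.

Lemma tens_rel_null d : tens_rel d -> to_tens d = 0.
Proof.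
move=> rel_d; rewrite -to_tens0; apply/to_tensP; rewrite subr0.
by apply/asboolP => N; apply.
Qed.

Lemma tensorDl m m' x : tensor (m + m') x = tensor m x + tensor m' x.
Proof.
apply/eqP; rewrite -subr_eq0 opprD addrA; apply/eqP.
by rewrite -!to_tensB; apply: tens_rel_null (TensDl _ _ _).
Qed.

Lemma tensorDr m x x' : tensor m (x + x') = tensor m x + tensor m x'.
Proof.
apply/eqP; rewrite -subr_eq0 opprD addrA; apply/eqP.
by rewrite -!to_tensB; apply: tens_rel_null (TensDr _ _ _).
Qed.

Lemma tensor_bal m r x : tensor (rscale m r) x = tensor m (r *: x).
Proof.
apply/eqP; rewrite -subr_eq0; apply/eqP.
by rewrite -!to_tensB; apply: tens_rel_null (TensBal _ _ _).
Qed.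

Lemma tens_ind (P : tens -> Prop) :
  P 0 -> (forall m x t, P t -> P (tensor m x + t)) ->
  (forall t, P t -> P (- t)) -> (forall t t', P t -> P t' -> P (t + t')) ->
  forall t, P t.
Proof.
move=> P0 Pt PN PD t; rewrite -[t](@reprK _ (Quotient.quot tens_null)).
rewrite -/(to_tens _); move: (repr _) => d; rewrite -(Freeg_enum d).
elim: (fgenum d) => [|[k [m x]] s IHs]; first by rewrite freeg_nil to_tens0.
rewrite -cat1s freeg_cat to_tensD; apply: PD => //.
have PM n : P (to_tens [freeg [:: (n%:Z, (m, x))]]).
  rewrite -[n%:Z]natz -freegU_muln; elim: n => [|n IHn]; first by rewrite to_tens0.
  by rewrite mulrS to_tensD; apply: Pt.
case: k => n //; rewrite NegzE -freegUN -[- _]sub0r to_tensB to_tens0 sub0r.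
exact/PN.
Qed.

(* Universal property: additive maps out of the tensor product are the
   balanced biadditive maps. *)
Record balanced (V : zmodType) := Balanced {
  bal_fun :> M -> X -> V;
  balDl : forall m m' x, bal_fun (m + m') x = bal_fun m x + bal_fun m' x;
  balDr : forall m x x', bal_fun m (x + x') = bal_fun m x + bal_fun m x';
  bal_bal : forall m r x, bal_fun (rscale m r) x = bal_fun m (r *: x)
}.

Section Lift.
Variables (V : zmodType) (f : balanced V).

Definition free_lift (d : F) : V :=
  fglift (fun mx : M * X => f mx.1 mx.2 : zmodule V) d.

Fact free_lift_additive : {morph free_lift : d e / d - e}.
Proof. by move=> d e; rewrite /free_lift lift_is_additive. Qed.

Lemma free_liftU m x : free_lift (m |*| x) = f m x.
Proof. by rewrite /free_lift liftU scale1r. Qed.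

Definition lift_null : {pred F} := fun d => free_lift d == 0.
Fact lift_null_closed : zmod_closed lift_null.
Proof.
have fl0 : free_lift 0 = 0 by have := free_lift_additive 0 0; rewrite !subrr.
split=> [|d e /eqP fd /eqP fe]; first exact/eqP.
by apply/eqP; rewrite free_lift_additive fd fe subrr.
Qed.
HB.instance Definition _ := GRing.isZmodClosed.Build F lift_null lift_null_closed.

Definition tens_lift (t : tens) : V := free_lift (repr (t : Quotient.quot tens_null)).

Lemma tens_lift_to d : tens_lift (to_tens d) = free_lift d.
Proof.
apply/eqP; rewrite -subr_eq0 /tens_lift -free_lift_additive.
have /asboolP : repr (to_tens d : Quotient.quot tens_null) - d \in tens_null.
  by apply/to_tensP; rewrite /to_tens reprK.
move=> /(_ lift_null) relN; apply: relN => _ [] *; apply/eqP; rewrite !free_lift_additive !free_liftU.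
- by rewrite balDl addrAC addrK subrr.
- by rewrite balDr addrAC addrK subrr.
- by rewrite bal_bal subrr.
Qed.

Lemma tens_liftE m x : tens_lift (tensor m x) = f m x.
Proof. by rewrite tens_lift_to free_liftU. Qed.

Fact tens_lift_additive : zmod_morphism tens_lift.
Proof.
move=> t u; rewrite -[t](@reprK _ (Quotient.quot tens_null)).
rewrite -[u](@reprK _ (Quotient.quot tens_null)) -!/(to_tens _).
by rewrite -to_tensB !tens_lift_to free_lift_additive.
Qed.
HB.instance Definition _ :=
  GRing.isZmodMorphism.Build tens V tens_lift tens_lift_additive.

End Lift.

Lemma tens_ext (V : zmodType) (f g : {additive tens -> V}) :
  (forall m x, f (tensor m x) = g (tensor m x)) -> f =1 g.
Proof.
move=> fg; elim/tens_ind => [|m x t IH|t IH|t u IHt IHu].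
- by rewrite !raddf0.
- by rewrite !raddfD IH /= fg.
- by rewrite !raddfN IH.
- by rewrite !raddfD IHt IHu.
Qed.

(* r (m (x) x) = (r m) (x) x *)
Definition tens_scale_bal (r : R) : balanced tens.
Proof.
exists (fun m x => tensor (r *: m) x) => [m m' x|m x x'|m r' x].
- by rewrite scalerDr tensorDl.
- by rewrite tensorDr.
- by rewrite rscale_scale tensor_bal.
Defined.

Definition tens_scale (r : R) (t : tens) : tens := tens_lift (tens_scale_bal r) t.

Lemma tens_scaleE r m x : tens_scale r (tensor m x) = tensor (r *: m) x.
Proof. by rewrite /tens_scale tens_liftE. Qed.

Fact tens_scaleDr : right_distributive tens_scale +%R.
Proof. by move=> r t u; rewrite /tens_scale raddfD. Qed.

Lemma tens_scaleN r t : tens_scale r (- t) = - tens_scale r t.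
Proof. by rewrite /tens_scale raddfN. Qed.

Lemma tens_scale0 r : tens_scale r 0 = 0.
Proof. by rewrite /tens_scale raddf0. Qed.

Fact tens_scaleA a b t : tens_scale a (tens_scale b t) = tens_scale (a * b) t.
Proof.
elim/tens_ind: t => [|m x t IH|t IH|t u IHt IHu].
- by rewrite !tens_scale0.
- by rewrite !tens_scaleDr IH !tens_scaleE scalerA.
- by rewrite !tens_scaleN IH.
- by rewrite !tens_scaleDr IHt IHu.
Qed.

Fact tens_scale1 : left_id 1 tens_scale.
Proof.
elim/tens_ind => [|m x t IH|t IH|t u IHt IHu].
- by rewrite !tens_scale0.
- by rewrite !tens_scaleDr IH !tens_scaleE scale1r.
- by rewrite !tens_scaleN IH.
- by rewrite !tens_scaleDr IHt IHu.
Qed.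

Fact tens_scaleDl t : {morph tens_scale^~ t : a b / a + b}.
Proof.
move=> a b; elim/tens_ind: t => [|m x t IH|t IH|t u IHt IHu].
- by rewrite !tens_scale0 addr0.
- by rewrite !tens_scaleDr IH !tens_scaleE scalerDl tensorDl addrACA.
- by rewrite !tens_scaleN IH opprD.
- by rewrite !tens_scaleDr IHt IHu addrACA.
Qed.

HB.instance Definition _ := GRing.Zmodule_isLmodule.Build R tens
  tens_scaleA tens_scale1 tens_scaleDr tens_scaleDl.

Lemma tensorZ r m x : r *: tensor m x = tensor (r *: m) x.
Proof. exact: tens_scaleE. Qed.

End Tensor.

Section TensMap.
Variables (R : pzRingType) (M : bimod R) (X Y : lmodType R) (f : {linear X -> Y}).

Definition tens_map_bal : balanced M X (tens M Y).
Proof.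
exists (fun m x => tensor m (f x)) => [m m' x|m x x'|m r x].
- by rewrite tensorDl.
- by rewrite raddfD tensorDr.
- by rewrite linearZ tensor_bal.
Defined.

Definition tens_map (t : tens M X) : tens M Y := tens_lift tens_map_bal t.

Lemma tens_mapE m x : tens_map (tensor m x) = tensor m (f x).
Proof. by rewrite /tens_map tens_liftE. Qed.

Fact tens_map_linear : linear tens_map.
Proof.
move=> r t u; rewrite /tens_map raddfD; congr (_ + _).
elim/tens_ind: t => [|m x t IH|t IH|t t' IHt IHt'].
- by rewrite scaler0 !raddf0.
- by rewrite scalerDr !raddfD /= IH tensorZ !tens_liftE tensorZ.
- by rewrite scalerN !raddfN IH.
- by rewrite scalerDr !raddfD /= IHt IHt'.
Qed.
HB.instance Definition _ :=
  GRing.isLinear.Build R (tens M X) (tens M Y) _ tens_map tens_map_linear.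

End TensMap.
Arguments tens_map {R} M {X Y} f t.

(* Tor_i(M, A) is the i-th homology of M (x) P, for P a projective resolution
   of A. *)
Definition Tor_zero (R : pzRingType) (i : nat) (M : bimod R) (A : lmodType R) :
    Prop :=
  forall P : resolution A, (forall j, projective (P j)) ->
    match i with
    | 0%N => surjective (tens_map M (res_d P 0%N))
    | j.+1 => exact (tens_map M (res_d P j.+1)) (tens_map M (res_d P j))
    end.

Section Hom.
Variables (R : pzRingType) (M : bimod R) (Y : lmodType R).

Record lhom := Hom { hom_fun :> M -> Y; hom_linear : linear hom_fun }.
HB.instance Definition _ := gen_eqMixin lhom.
HB.instance Definition _ := gen_choiceMixin lhom.

Lemma homP (f g : lhom) : f =1 g -> f = g.
Proof.
case: f g => [f fl] [g gl] /= /funext fg; subst g; congr Hom; exact: Prop_irrelevance.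
Qed.

HB.instance Definition _ (f : lhom) := GRing.isLinear.Build R M Y _ f (hom_linear f).

Definition hom_zero : lhom.
Proof. by exists (fun=> 0) => r m m'; rewrite scaler0 addr0. Defined.

Definition hom_opp (f : lhom) : lhom.
Proof. by exists (fun m => - f m) => r m m'; rewrite linearP opprD scalerN. Defined.

Definition hom_add (f g : lhom) : lhom.
Proof.
by exists (fun m => f m + g m) => r m m'; rewrite !linearP scalerDr addrACA.
Defined.

(* (r f)(m) = f (m r) *)
Definition hom_scale (r : R) (f : lhom) : lhom.
Proof.
by exists (fun m => f (rscale m r)) => s m m'; rewrite rscaleDl -rscale_scale linearP.
Defined.

Fact hom_addA : associative hom_add.
Proof. by move=> f g h; apply: homP => m /=; rewrite addrA. Qed.
Fact hom_addC : commutative hom_add.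
Proof. by move=> f g; apply: homP => m /=; rewrite addrC. Qed.
Fact hom_add0 : left_id hom_zero hom_add.
Proof. by move=> f; apply: homP => m /=; rewrite add0r. Qed.
Fact hom_addN : left_inverse hom_zero hom_opp hom_add.
Proof. by move=> f; apply: homP => m /=; rewrite addNr. Qed.
HB.instance Definition _ :=
  GRing.isZmodule.Build lhom hom_addA hom_addC hom_add0 hom_addN.

Fact hom_scaleA a b f : hom_scale a (hom_scale b f) = hom_scale (a * b) f.
Proof. by apply: homP => m /=; rewrite rscaleA. Qed.
Fact hom_scale1 : left_id 1 hom_scale.
Proof. by move=> f; apply: homP => m /=; rewrite rscale1. Qed.
Fact hom_scaleDr : right_distributive hom_scale +%R.
Proof. by move=> r f g; apply: homP. Qed.
Fact hom_scaleDl f : {morph hom_scale^~ f : a b / a + b}.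
Proof. by move=> a b; apply: homP => m /=; rewrite rscaleDr raddfD. Qed.
HB.instance Definition _ := GRing.Zmodule_isLmodule.Build R lhom
  hom_scaleA hom_scale1 hom_scaleDr hom_scaleDl.

End Hom.

Section HomMap.
Variables (R : pzRingType) (M : bimod R) (X Y : lmodType R) (f : {linear X -> Y}).

Definition hom_map (h : lhom M X) : lhom M Y.
Proof. by exists (fun m => f (h m)) => r m m'; rewrite !linearP. Defined.

Fact hom_map_linear : linear hom_map.
Proof. by move=> r h k; apply: homP => m /=; rewrite raddfD. Qed.
HB.instance Definition _ :=
  GRing.isLinear.Build R (lhom M X) (lhom M Y) _ hom_map hom_map_linear.

End HomMap.
Arguments hom_map {R} M {X Y} f h.

Section TrivialExtension.
Variables (R : pzRingType) (M : bimod R).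

Definition trivext : Type := (R * M)%type.
HB.instance Definition _ := GRing.Zmodule.on trivext.

Definition te_one : trivext := (1, 0).
Definition te_mul (a b : trivext) : trivext :=
  (a.1 * b.1, a.1 *: b.2 + rscale a.2 b.1).

Fact te_mulA : associative te_mul.
Proof.
move=> [a x] [b y] [c z]; congr (_, _) => /=; first by rewrite mulrA.
by rewrite scalerDr rscaleDl rscaleA scalerA -rscale_scale addrA.
Qed.
Fact te_mul1l : left_id te_one te_mul.
Proof. by move=> [a x]; congr (_, _); rewrite /= ?mul1r // scale1r rscale0l addr0. Qed.
Fact te_mul1r : right_id te_one te_mul.
Proof. by move=> [a x]; congr (_, _); rewrite /= ?mulr1 // scaler0 rscale1 add0r. Qed.
Fact te_mulDl : left_distributive te_mul +%R.
Proof.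
move=> [a x] [b y] [c z]; congr (_, _); rewrite /= ?mulrDl //.
by rewrite scalerDl rscaleDl addrACA.
Qed.
Fact te_mulDr : right_distributive te_mul +%R.
Proof.
move=> [a x] [b y] [c z]; congr (_, _); rewrite /= ?mulrDr //.
by rewrite scalerDr rscaleDr addrACA.
Qed.
HB.instance Definition _ := GRing.Zmodule_isPzRing.Build trivext
  te_mulA te_mul1l te_mul1r te_mulDl te_mulDr.

Definition te_l (r : R) : trivext := (r, 0).
Definition te_r (m : M) : trivext := (0, m).

Lemma te_lD a b : te_l (a + b) = te_l a + te_l b.
Proof. by congr (_, _); rewrite addr0. Qed.
Lemma te_rD m m' : te_r (m + m') = te_r m + te_r m'.
Proof. by congr (_, _); rewrite addr0. Qed.
Lemma te_lM a b : te_l a * te_l b = te_l (a * b).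
Proof. by congr (_, _); rewrite /= scaler0 rscale0l addr0. Qed.
Lemma te_lrM r m : te_l r * te_r m = te_r (r *: m).
Proof. by congr (_, _); rewrite /= ?mulr0 // rscale0r addr0. Qed.
Lemma te_rlM m r : te_r m * te_l r = te_r (rscale m r).
Proof. by congr (_, _); rewrite /= ?mul0r // scale0r add0r. Qed.
Lemma te_rrM m m' : te_r m * te_r m' = 0.
Proof. by congr (_, _); rewrite /= ?mul0r // scale0r rscale0r addr0. Qed.

End TrivialExtension.

(* A module X over the trivial extension is identified with the pair
   (restr X, alpha X), and with the pair [restr X, beta X]. *)
Section StructureMaps.
Variables (R : pzRingType) (M : bimod R) (X : lmodType (trivext M)).

(* X as a left R-module, by restriction of scalars along r |-> (r, 0) *)
Definition restr : Type := X.
HB.instance Definition _ := GRing.Zmodule.on restr.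

Definition restr_scale (r : R) (x : restr) : restr := te_l M r *: (x : X).
Fact restr_scaleA a b x : restr_scale a (restr_scale b x) = restr_scale (a * b) x.
Proof. by rewrite /restr_scale scalerA te_lM. Qed.
Fact restr_scale1 : left_id 1 restr_scale.
Proof. exact: (@scale1r _ X). Qed.
Fact restr_scaleDr : right_distributive restr_scale +%R.
Proof. by move=> r x y; exact: (@scalerDr _ X). Qed.
Fact restr_scaleDl x : {morph restr_scale^~ x : a b / a + b}.
Proof. by move=> a b; rewrite /restr_scale te_lD scalerDl. Qed.
HB.instance Definition _ := GRing.Zmodule_isLmodule.Build R restr
  restr_scaleA restr_scale1 restr_scaleDr restr_scaleDl.

Definition mact (m : M) (x : restr) : restr := te_r m *: (x : X).

Lemma mactDl m m' x : mact (m + m') x = mact m x + mact m' x.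
Proof. by rewrite /mact te_rD scalerDl. Qed.
Lemma mactDr m x x' : mact m (x + x') = mact m x + mact m x'.
Proof. exact: (@scalerDr _ X). Qed.
Lemma mact_bal m r x : mact (rscale m r) x = mact m (r *: x).
Proof. by rewrite /mact -te_rlM -scalerA. Qed.
Lemma mactZ r m x : r *: mact m x = mact (r *: m) x.
Proof. by rewrite /mact -te_lrM -scalerA. Qed.
Lemma mact_mact m m' x : mact m (mact m' x) = 0.
Proof. by rewrite /mact scalerA te_rrM scale0r. Qed.

(* alpha (m (x) x) = (0, m) x *)
Definition alpha_fun (t : tens M restr) : restr :=
  tens_lift (Balanced mactDl mactDr mact_bal) t.

Fact alpha_linear : linear alpha_fun.
Proof.
move=> r t u; rewrite /alpha_fun raddfD; congr (_ + _).
elim/tens_ind: t => [|m x t IH|t IH|t t' IHt IHt'].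
- by rewrite scaler0 !raddf0.
- by rewrite scalerDr !raddfD /= IH tensorZ !tens_liftE mactZ.
- by rewrite scalerN !raddfN IH.
- by rewrite scalerDr !raddfD /= IHt IHt'.
Qed.
HB.instance Definition _ :=
  GRing.isLinear.Build R (tens M restr) restr _ alpha_fun alpha_linear.

Definition alpha : {linear tens M restr -> restr} := alpha_fun.

Lemma alphaE m x : alpha (tensor m x) = mact m x.
Proof. by rewrite /alpha /= /alpha_fun tens_liftE. Qed.

Definition beta_fun (y : restr) : lhom M restr.
Proof. by exists (fun m => mact m y) => r m m'; rewrite mactDl mactZ. Defined.

Fact beta_linear : linear beta_fun.
Proof. by move=> r x y; apply: homP => m /=; rewrite mactDr -mact_bal. Qed.
HB.instance Definition _ :=
  GRing.isLinear.Build R restr (lhom M restr) _ beta_fun beta_linear.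

Definition beta : {linear restr -> lhom M restr} := beta_fun.

Lemma betaE y m : beta y m = mact m y.
Proof. by []. Qed.

End StructureMaps.

Section IsoTransport.
Variable R : pzRingType.

Lemma linear_inverse (A B : lmodType R) (f : {linear A -> B}) :
  bijective f -> exists g : {linear B -> A}, cancel f g /\ cancel g f.
Proof.
case=> g fg gf; have gl : linear g.
  by move=> r x y; apply: (can_inj fg); rewrite linearP !gf.
pose g' : {linear B -> A} := HB.pack g (GRing.isLinear.Build _ _ _ _ g gl).
by exists g'.
Qed.

Lemma exact_iso (A B C A' B' C' : lmodType R)
    (f : {linear A -> B}) (g : {linear B -> C})
    (f' : {linear A' -> B'}) (g' : {linear B' -> C'})
    (u : A -> A') (v : {linear B -> B'}) (w : {linear C -> C'}) :
  bijective u -> bijective v -> bijective w ->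
  (forall a, f' (u a) = v (f a)) -> (forall b, g' (v b) = w (g b)) ->
  exact f g -> exact f' g'.
Proof.
move=> [u' uK u'K] [v' vK v'K] [w' wK _] fu gv fg b'.
rewrite -[b']v'K gv; split=> [|[a' /esym]].
  rewrite -[0](raddf0 w) => /(can_inj wK) /fg [a <-].
  by exists (u a); rewrite fu.
rewrite -[a']u'K fu => /(can_inj vK) vb.
by have /fg -> : exists a, f a = v' b'; [exists (u' a')|rewrite raddf0].
Qed.

Lemma tens_map_bij (M : bimod R) (A B : lmodType R) (f : {linear A -> B}) :
  bijective f -> bijective (tens_map M f).
Proof.
case/linear_inverse=> g [fK gK]; exists (tens_map M g) => t.
  by apply: (@tens_ext _ _ _ _ (tens_map M g \o tens_map M f) idfun) => m x /=;
     rewrite !tens_mapE fK.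
by apply: (@tens_ext _ _ _ _ (tens_map M f \o tens_map M g) idfun) => m x /=;
   rewrite !tens_mapE gK.
Qed.

Lemma hom_map_bij (M : bimod R) (A B : lmodType R) (f : {linear A -> B}) :
  bijective f -> bijective (hom_map M f).
Proof.
case/linear_inverse=> g [fK gK].
by exists (hom_map M g) => h; apply: homP => m /=; rewrite ?fK ?gK.
Qed.

Section KerCokerIso.
Variables (A B A' B' : lmodType R) (f : {linear A -> B}) (f' : {linear A' -> B'}).
Variables (u : {linear A -> A'}) (v : {linear B -> B'}).
Hypotheses (fu : forall a, f' (u a) = v (f a)) (ub : bijective u) (vb : bijective v).

Lemma coker_iso : exists h : {linear coker f -> coker f'}, bijective h.
Proof.
have [u' [uK u'K]] := linear_inverse ub; have [v' [vK v'K]] := linear_inverse vb.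
pose h (c : coker f) : coker f' := to_coker f' (v (repr c)).
have hE b : h (to_coker f b) = to_coker f' (v b).
  apply/to_cokerP; have /to_cokerP[a fa] : to_coker f (repr (to_coker f b)) = to_coker f b.
    by rewrite /to_coker reprK.
  by exists (u a); rewrite fu fa raddfB.
have h_lin : linear h.
  move=> r x y; have [b <-] := to_coker_surj x; have [b' <-] := to_coker_surj y.
  rewrite -[r *: to_coker f b]/(coker_scale r _) to_cokerZ -to_cokerD !hE.
  by rewrite -[r *: to_coker f' _]/(coker_scale r _) to_cokerZ -to_cokerD linearP.
pose h' : {linear coker f -> coker f'} := HB.pack h (GRing.isLinear.Build _ _ _ _ h h_lin).
exists h'; exists (fun c => to_coker f (v' (repr c))) => x.
  have [b <-] := to_coker_surj x; rewrite /= hE; apply/to_cokerP.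
  have /to_cokerP[a fa] :
      to_coker f' (repr (to_coker f' (v b))) = to_coker f' (v b).
    by rewrite /to_coker reprK.
  exists (u' a); apply: (can_inj vK).
  by rewrite -fu u'K fa raddfB /= v'K.
by rewrite /= hE v'K /to_coker reprK.
Qed.

Lemma ker_iso : exists h : {linear ker f -> ker f'}, bijective h.
Proof.
have [u' [uK u'K]] := linear_inverse ub; have [v' [vK v'K]] := linear_inverse vb.
have hP (a : ker f) : f' (u (\val a)) = 0.
  by rewrite fu kerP raddf0.
have hP' (a : ker f') : f (u' (\val a)) = 0.
  by apply: (can_inj vK); rewrite -fu u'K kerP raddf0.
pose h (a : ker f) : ker f' := to_ker (hP a).
have h_lin : linear h.
  by move=> r x y; apply: val_inj; rewrite /= linearP.
pose h' : {linear ker f -> ker f'} := HB.pack h (GRing.isLinear.Build _ _ _ _ h h_lin).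
by exists h'; exists (fun a => to_ker (hP' a)) => x; apply: val_inj; rewrite /= ?uK ?u'K.
Qed.

End KerCokerIso.
End IsoTransport.

Section TrivextClasses.
Variables (R : pzRingType) (M : bimod R).

Section RestrMap.
Variables (X Y : lmodType (trivext M)) (f : {linear X -> Y}).

Definition restr_map (x : restr X) : restr Y := f x.
Fact restr_map_linear : linear restr_map.
Proof. by move=> r x y; apply: linearP. Qed.
HB.instance Definition _ :=
  GRing.isLinear.Build R (restr X) (restr Y) _ restr_map restr_map_linear.

Lemma restr_map_mact m x : restr_map (mact m x) = mact m (restr_map x).
Proof. exact: linearZ. Qed.

Lemma restr_map_alpha t : alpha Y (tens_map M restr_map t) = restr_map (alpha X t).
Proof.
apply: (@tens_ext _ _ _ _ (alpha Y \o tens_map M restr_map)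
                          (restr_map \o alpha X)) => m x /=.
by rewrite tens_mapE !alphaE restr_map_mact.
Qed.

Lemma restr_map_beta y : beta Y (restr_map y) = hom_map M restr_map (beta X y).
Proof. by apply: homP => m; rewrite betaE /= restr_map_mact. Qed.

End RestrMap.

Variable C : modclass R.

Definition U_mem (X : lmodType (trivext M)) : Prop := C (restr X).

Definition B_mem (X : lmodType (trivext M)) : Prop :=
  C (coker (alpha X)) /\ exact (tens_map M (alpha X)) (alpha X).

Definition J_mem (Y : lmodType (trivext M)) : Prop :=
  C (ker (beta Y)) /\ exact (beta Y) (hom_map M (beta Y)).

Fact U_mem0 (X : lmodType (trivext M)) : (forall x : X, x = 0) -> U_mem X.
Proof. by move=> X0; apply: class0. Qed.
Fact U_mem_iso (X Y : lmodType (trivext M)) (f : {linear X -> Y}) :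
  bijective f -> U_mem X -> U_mem Y.
Proof. by move=> fb; apply: class_iso (restr_map f) _. Qed.

Definition frakU : modclass (trivext M) := Modclass U_mem0 U_mem_iso.

Lemma tens_zero (X : lmodType R) : (forall x : X, x = 0) -> forall t : tens M X, t = 0.
Proof.
move=> X0; elim/tens_ind => [//|m x t ->|t ->|t t' -> ->]; rewrite ?oppr0 ?addr0 //.
by rewrite (X0 x); apply: (addrI (tensor m 0)); rewrite -tensorDr !addr0.
Qed.

Fact B_mem0 (X : lmodType (trivext M)) : (forall x : X, x = 0) -> B_mem X.
Proof.
move=> X0; split=> [|t].
  apply: class0 => c; have [b <-] := to_coker_surj c.
  by rewrite (X0 b) /to_coker raddf0.
split=> _; last exact: X0.
by exists 0; rewrite [RHS](@tens_zero (restr X) X0) raddf0.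
Qed.
Fact B_mem_iso (X Y : lmodType (trivext M)) (f : {linear X -> Y}) :
  bijective f -> B_mem X -> B_mem Y.
Proof.
move=> fb [CX eX]; have rb : bijective (restr_map f) by exact: fb.
have tb := tens_map_bij M rb.
have [h hb] := coker_iso (@restr_map_alpha _ _ f) tb rb.
split; first exact: class_iso hb CX.
apply: exact_iso (tens_map_bij M tb) tb rb _ (@restr_map_alpha _ _ f) eX => t.
apply: (@tens_ext _ _ _ _
  (tens_map M (alpha Y) \o tens_map M (tens_map M (restr_map f)))
  (tens_map M (restr_map f) \o tens_map M (alpha X))) => m x /=.
by rewrite !tens_mapE restr_map_alpha.
Qed.

Definition frakB : modclass (trivext M) := Modclass B_mem0 B_mem_iso.

Fact J_mem0 (X : lmodType (trivext M)) : (forall x : X, x = 0) -> J_mem X.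
Proof.
move=> X0; split=> [|h].
  by apply: class0 => k; apply: val_inj; apply: X0.
have -> : h = 0 by apply: homP => m; rewrite [LHS](X0 _) [RHS](X0 _).
by split=> _; [exists 0; rewrite raddf0|rewrite raddf0].
Qed.
Fact J_mem_iso (X Y : lmodType (trivext M)) (f : {linear X -> Y}) :
  bijective f -> J_mem X -> J_mem Y.
Proof.
move=> fb [CX eX]; have rb : bijective (restr_map f) by exact: fb.
have hb := hom_map_bij M rb.
have [h kb] := ker_iso (@restr_map_beta _ _ f) rb hb.
split; first exact: class_iso kb CX.
apply: exact_iso rb hb (hom_map_bij M hb) (@restr_map_beta _ _ f) _ eX => k.
by apply: homP => m /=; rewrite restr_map_beta.
Qed.

Definition frakJ : modclass (trivext M) := Modclass J_mem0 J_mem_iso.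

End TrivextClasses.

(* Main.v *)
From HB Require Import structures.
From mathcomp Require Import all_boot all_algebra.
From mathcomp Require Import boolp.
Require Import Defs.

Set Implicit Arguments.
Unset Strict Implicit.
Unset Printing Implicit Defensive.

(** Write S for the trivial extension of R by M. Restriction of scalars from S
    to R has a right adjoint [coind], with [coind F] = F x Hom(M, F), and a left
    adjoint [ind], with [ind A] = A x (M (x) A). A module Y lies in the class J^D
    exactly when it is an extension of Hom(M, F) by F, with F in D, on which M
    acts in the evident way ([frakJP]), and [coind F] is the split extension of
    this kind. Ext^1(Hom(M, F), F) = 0 forces every such Y to be [coind F]
    ([coind_ext_iso]). Dually B^C consists of extensions of A by M (x) A
    ([frakBP]), which Ext^1(A, M (x) A) = 0 forces to be [ind A]
    ([ind_ext_iso]).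

    Orthogonality is then an adjunction. In the left case
    Ext^1_S(X, coind F) = 0 follows from Ext^1_R(X, F) = 0 ([ext1_coind]);
    higher Ext reduces to Ext^1 because U^C is resolving and contains the
    projective S-modules, so that syzygies of modules in U^C stay in U^C
    ([Ext_zero_hereditary]). In the right case the vanishing of Tor_i(M, A) lets
    [ind] turn syzygies of A over R into syzygies of [ind A] over S, far enough
    to compare Ext^i_S(ind A, Y) with Ext^i_R(A, Y) for i <= n
    ([Ext_zero_ind]).

    For the approximations of an S-module X in the left case, take one over R, a
    sequence 0 -> K -> E0 -> X -> 0 with E0 in C and K of D-dimension below n; all
    dimensions that follow are bounded in this way and called finite.
    The functor [coind] keeps it exact, as Ext^1(M, K) = 0, and pulling it back
    along the unit X -> [coind X] gives an S-sequence 0 -> coind K -> E -> X -> 0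
    whose kernel has finite J^D-dimension. Over R, the module E is an extension
    of E0 by Hom(M, K), so all that remains is Hom(M, K) in C, that is,
    Ext^1(Hom(M, K), G) = 0 for every G of finite D-dimension. The hypothesis
    only gives Ext^1(Hom(M, F), F) = 0, but F may be taken to be K x G, provided
    that K x G has finite D-dimension. This is where closure of the modules of
    finite J^D-dimension under extensions enters: [coind (K x G)], being an
    extension of [coind G] by [coind K], has finite J^D-dimension, and this
    dimension bounds the D-dimension of the kernel K x G of the structure map
    ([coind_ext_res_dim]). The right case is dual, with a pushout along the
    counit [ind X] -> X.

    The consequences of the long exact sequences of Ext and Tor that this takes
    are derived from one induction on syzygies, which never mentions connecting
    maps ([shift_closed], [shift_of_presentation]). *)

Import GRing.Theory.
Local Open Scope ring_scope.

(** * Linear maps, pullbacks and pushouts *)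

Section LinearMaps.
Variable R : pzRingType.
Implicit Types A B C : lmodType R.

Definition mklin A B (f : A -> B) (f_lin : linear f) : {linear A -> B} :=
  HB.pack f (GRing.isLinear.Build R A B _ f f_lin).

Lemma factor_surj A B C (g : {linear A -> B}) (h : {linear A -> C}) :
  surjective g -> (forall a, g a = 0 -> h a = 0) ->
  exists k : {linear B -> C}, forall a, k (g a) = h a.
Proof.
move=> /choice[s sK] gh.
have hs a : h (s (g a)) = h a.
  by apply/eqP; rewrite -subr_eq0 -raddfB; apply/eqP/gh; rewrite raddfB /= sK subrr.
have k_lin : linear (fun b => h (s b)).
  by move=> r x y; rewrite -[x]sK -[y]sK -linearP !hs linearP.
by exists (mklin k_lin).
Qed.

Lemma factor_inj A B C (f : {linear A -> B}) (h : {linear C -> B}) :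
  injective f -> (forall c, exists a, f a = h c) ->
  exists k : {linear C -> A}, forall c, f (k c) = h c.
Proof.
move=> f_inj /choice[k kK].
have k_lin : linear k by move=> r x y; apply: f_inj; rewrite linearP !kK linearP.
by exists (mklin k_lin).
Qed.

Lemma ker_short_exact A B (g : {linear A -> B}) :
  surjective g -> short_exact (\val : ker g -> A) g.
Proof.
move=> g_surj; split=> // [|a]; first exact: val_inj.
by split=> [ga|[k <-]]; [exists (to_ker ga) | apply: kerP].
Qed.

Fact to_coker_linear A B (f : {linear A -> B}) : linear (to_coker f).
Proof. by move=> r x y; rewrite to_cokerD -to_cokerZ. Qed.

Definition coker_proj A B (f : {linear A -> B}) : {linear B -> coker f} :=
  mklin (@to_coker_linear A B f).

Lemma coker_proj_surj A B (f : {linear A -> B}) : surjective (coker_proj f).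
Proof. exact: to_coker_surj. Qed.

Lemma coker_proj_eq0 A B (f : {linear A -> B}) b :
  coker_proj f b = 0 <-> exists a, f a = b.
Proof. by rewrite -[0](raddf0 (coker_proj f)) to_cokerP subr0. Qed.

Lemma coker_short_exact A B (f : {linear A -> B}) :
  injective f -> short_exact f (coker_proj f).
Proof.
by move=> f_inj; split=> // [b|c]; [apply: coker_proj_eq0 | apply: coker_proj_surj].
Qed.

Lemma pair_inl_linear A B : linear (fun a : A => (a, 0) : (A * B)%type).
Proof. by move=> r x y; congr (_, _); rewrite /= scaler0 addr0. Qed.
Lemma pair_inr_linear A B : linear (fun b : B => (0, b) : (A * B)%type).
Proof. by move=> r x y; congr (_, _); rewrite /= scaler0 addr0. Qed.
Definition inl_lin A B : {linear A -> (A * B)%type} := mklin (@pair_inl_linear A B).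
Definition inr_lin A B : {linear B -> (A * B)%type} := mklin (@pair_inr_linear A B).

Lemma pullback A B C C' (f : {linear A -> B}) (g : {linear B -> C})
    (u : {linear C' -> C}) :
  short_exact f g ->
  exists (E : lmodType R) (f' : {linear A -> E}) (g' : {linear E -> C'})
      (v : {linear E -> B}),
    [/\ short_exact f' g', forall a, v (f' a) = f a
      & forall e, g (v e) = u (g' e)].
Proof.
case=> f_inj fg g_surj.
have d_lin : linear (fun x : (B * C')%type => g x.1 - u x.2).
  by move=> r x y; rewrite [LHS]/= [g _]linearP [u _]linearP scalerBr opprD addrACA.
pose E : lmodType R := ker (mklin d_lin).
have f'P a : mklin d_lin (f a, 0) = 0.
  by rewrite /= raddf0 subr0; apply/fg; exists a.
have f'_lin : linear (fun a => to_ker (f'P a)).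
  by move=> r x y; apply: val_inj; congr (_, _); rewrite /= ?linearP // scaler0 addr0.
have g'_lin : linear (fun e : E => (\val e).2) by [].
have v_lin : linear (fun e : E => (\val e).1) by [].
exists E, (mklin f'_lin), (mklin g'_lin), (mklin v_lin).
have sq (e : E) : g (\val e).1 = u (\val e).2.
  by apply/eqP; rewrite -subr_eq0; apply/eqP/(kerP e).
split=> [|//|e]; last exact: sq.
split=> [a b /(congr1 \val)[/f_inj]//|e|c].
  split=> [/= e2|[a <-]//].
  have /fg[a fa] : g (\val e).1 = 0 by rewrite sq e2 raddf0.
  by exists a; apply: val_inj; rewrite [RHS]surjective_pairing; congr (_, _).
have [b gb] := g_surj (u c).
have ebP : mklin d_lin (b, c) = 0 by rewrite /= gb subrr.
by exists (to_ker ebP).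
Qed.

Lemma pushout A A' B C (f : {linear A -> B}) (g : {linear B -> C})
    (u : {linear A -> A'}) :
  short_exact f g ->
  exists (E : lmodType R) (f' : {linear A' -> E}) (g' : {linear E -> C})
      (v : {linear B -> E}),
    [/\ short_exact f' g', forall a, v (f a) = f' (u a)
      & forall b, g' (v b) = g b].
Proof.
case=> f_inj fg g_surj.
have d_lin : linear (fun a => (u a, - f a) : (A' * B)%type).
  by move=> r x y; congr (_, _); rewrite /= linearP // opprD scalerN.
pose d := mklin d_lin; pose p := coker_proj d.
have h_lin : linear (fun x : (A' * B)%type => g x.2).
  by move=> r x y; rewrite /= linearP.
have gf a : g (f a) = 0 by apply/fg; exists a.
have [g' g'p] : exists k : {linear coker d -> C}, forall a, k (p a) = mklin h_lin a.
  apply: factor_surj; first exact: coker_proj_surj.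
  by move=> x /coker_proj_eq0[a <-] /=; rewrite raddfN /= gf oppr0.
exists (coker d), (p \o @inl_lin A' B), g', (p \o @inr_lin A' B).
split=> [|a|b]; last by rewrite /= g'p.
  split=> [|e|c].
  - apply: raddf_inj => x /= /coker_proj_eq0[a [<- /eqP]].
    by rewrite oppr_eq0 => /eqP; rewrite -[RHS](raddf0 f) => /f_inj ->; rewrite raddf0.
  - have [[x b] <-] := coker_proj_surj e.
    rewrite g'p /=; split=> [/fg[a fa]|[y]].
      exists (x + u a); apply/eqP; rewrite -subr_eq0 -raddfB; apply/eqP.
      apply/coker_proj_eq0; exists a; rewrite /d /=; congr (_, _).
        by rewrite /= addrAC subrr add0r.
      by rewrite /= sub0r fa.
    move=> /eqP; rewrite -subr_eq0 -raddfB => /eqP/coker_proj_eq0[a].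
    by case=> _ /eqP; rewrite sub0r eqr_opp => /eqP <-.
  by have [b gb] := g_surj c; exists (p (0, b)); rewrite g'p.
apply/eqP; rewrite -subr_eq0 /= -raddfB; apply/eqP/coker_proj_eq0.
exists (- a); rewrite /d /=; congr (_, _) => /=.
  by rewrite raddfN /= sub0r.
by rewrite raddfN /= opprK subr0.
Qed.

End LinearMaps.

(** * Split sequences and the vanishing of the first Ext *)

Section SplitSequences.
Variable R : pzRingType.
Implicit Types A B C E K P W : lmodType R.

Lemma short_exact_comp0 A B C (f : {linear A -> B}) (g : {linear B -> C}) a :
  short_exact f g -> g (f a) = 0.
Proof. by case=> _ fg _; apply/fg; exists a. Qed.

Lemma section_of_retraction A B C (f : {linear A -> B}) (g : {linear B -> C})
    (p : {linear B -> A}) :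
  short_exact f g -> cancel f p -> exists s : {linear C -> B}, cancel s g.
Proof.
move=> fg_ex pf; have [_ fg g_surj] := fg_ex.
have [s sg] : exists s : {linear C -> B}, forall b, s (g b) = (idfun \- (f \o p)) b.
  by apply: factor_surj => // b /fg[a <-] /=; rewrite pf subrr.
exists s => c; have [b <-] := g_surj c.
by rewrite sg /= raddfB /= (short_exact_comp0 _ fg_ex) subr0.
Qed.

Lemma retraction_of_section A B C (f : {linear A -> B}) (g : {linear B -> C})
    (s : {linear C -> B}) :
  short_exact f g -> cancel s g -> exists p : {linear B -> A}, cancel f p.
Proof.
move=> fg_ex gs; have [f_inj fg g_surj] := fg_ex.
have [p fp] : exists p : {linear B -> A}, forall b, f (p b) = (idfun \- (s \o g)) b.
  by apply: factor_inj => // b; apply/fg; rewrite /= raddfB /= gs subrr.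
exists p => a; apply: f_inj.
by rewrite fp /= (short_exact_comp0 _ fg_ex) raddf0 subr0.
Qed.

Lemma projective_section B P (g : {linear B -> P}) :
  projective P -> surjective g -> exists s : {linear P -> B}, cancel s g.
Proof. by move=> P_proj g_surj; apply: (P_proj _ _ g idfun). Qed.

(** The vanishing of Ext^1(A, B), as an extension property for maps into B. In
    this form it needs no resolution of A, composes well along filtrations of A,
    and has the same shape as the vanishing of Tor_1 in [tor1]. *)
Definition ext1 A B : Prop :=
  forall K P (f : {linear K -> P}) (g : {linear P -> A}), short_exact f g ->
  forall u : {linear K -> B}, exists v : {linear P -> B}, forall k, v (f k) = u k.

Lemma ext1_retraction A B E (f : {linear B -> E}) (g : {linear E -> A}) :
  ext1 A B -> short_exact f g -> exists p : {linear E -> B}, cancel f p.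
Proof. by move=> AB fg; apply: (AB _ _ f g fg idfun). Qed.

Lemma ext1_section A B E (f : {linear B -> E}) (g : {linear E -> A}) :
  ext1 A B -> short_exact f g -> exists s : {linear A -> E}, cancel s g.
Proof.
by move=> AB fg; have [p pf] := ext1_retraction AB fg; apply: section_of_retraction pf.
Qed.

(** The dual of the extension property in [ext1]: pull the sequence back along
    [u] and split it. *)
Lemma ext1_lift A B C E (f : {linear B -> E}) (g : {linear E -> C})
    (u : {linear A -> C}) :
  ext1 A B -> short_exact f g -> exists v : {linear A -> E}, forall a, g (v a) = u a.
Proof.
move=> AB fg; have [W [f' [g' [v [fg' _ gv]]]]] := pullback u fg.
have [s g's] := ext1_section AB fg'.
by exists (v \o s) => a; rewrite /= gv g's.
Qed.

(** Pushing a sequence 0 -> K -> P -> A -> 0 out along K -> B gives an extension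
    of A by B; a splitting of it extends the map K -> B to P. *)
Lemma ext1_of_sections A B :
  (forall E (f : {linear B -> E}) (g : {linear E -> A}),
     short_exact f g -> exists s : {linear A -> E}, cancel s g) -> ext1 A B.
Proof.
move=> split_AB K P f g fg u.
have [E [f' [g' [v [fg' vf _]]]]] := pushout u fg.
have [s g's] := split_AB _ _ _ fg'.
have [p pf'] := retraction_of_section fg' g's.
by exists (p \o v) => k; rewrite /= vf pf'.
Qed.

(** A single projective presentation of A decides. Given an extension E of A by
    B, lift [g] to phi : P -> E; its restriction to K lands in B, and
    subtracting an extension of that restriction to P makes phi vanish on K, so
    that phi descends to a splitting. *)
Lemma ext1_of_presentation A B K P (f : {linear K -> P}) (g : {linear P -> A}) :
  short_exact f g -> projective P ->
  (forall u : {linear K -> B}, exists v : {linear P -> B}, forall k, v (f k) = u k) ->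
  ext1 A B.
Proof.
move=> fg P_proj extend; apply: ext1_of_sections => E i q iq.
have [[_ _ g_surj] [i_inj iqE q_surj]] := (fg, iq).
have [phi q_phi] := P_proj _ _ q g q_surj.
have [u iu] : exists u : {linear K -> B}, forall k, i (u k) = (phi \o f) k.
  by apply: factor_inj => // k; apply/iqE; rewrite /= q_phi (short_exact_comp0 _ fg).
have [v vf] := extend u.
have [s sg] : exists s : {linear A -> E}, forall x, s (g x) = (phi \- (i \o v)) x.
  apply: factor_surj => // x gx; have [_ fgE _] := fg.
  by have [k <-] := (fgE x).1 gx; rewrite /= vf iu subrr.
exists s => a; have [x <-] := g_surj a.
by rewrite sg /= raddfB /= q_phi (short_exact_comp0 _ iq) subr0.
Qed.

Lemma ext1_retract A A' B B' (i : {linear A -> A'}) (p : {linear A' -> A})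
    (i' : {linear B -> B'}) (p' : {linear B' -> B}) :
  cancel i p -> cancel i' p' -> ext1 A' B' -> ext1 A B.
Proof.
move=> pi pi' AB'; apply: ext1_of_sections => E f g fg.
have [W [f' [g' [v [fg' _ gv]]]]] := pullback p fg.
suff [s vs] : exists s : {linear A' -> E}, forall x, g (s x) = p x.
  by exists (s \o i) => a; rewrite /= vs pi.
have [w wf'] := AB' _ _ f' g' fg' i'.
have [s g's] : exists s : {linear A' -> W}, cancel s g'.
  apply: (section_of_retraction (p := p' \o w)) fg' _ => b.
  by rewrite /= wf' pi'.
by exists (v \o s) => x; rewrite /= gv g's.
Qed.

End SplitSequences.

(** * Finite resolutions, one short exact sequence at a time *)

Section Resolutions.
Variable R : pzRingType.
Implicit Types A B C E K P W : lmodType R.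

(** Splicing a short exact sequence 0 -> K -> B -> A -> 0 with a resolution of K
    gives a resolution of A, and with a coresolution of A one of K. *)
Section Prepend.
Variables (A B K : lmodType R) (f : {linear K -> B}) (g : {linear B -> A}).
Hypothesis fg : short_exact f g.

Section Cons.
Variable P : resolution K.

Definition cons_res_obj (i : nat) : lmodType R := if i is j.+1 then P j else B.
Definition cons_res_d i : {linear cons_res_obj i.+1 -> cons_res_obj i} :=
  match i with 0%N => f \o res_aug P | j.+1 => res_d P j end.

Fact cons_res_exact0 : exact (cons_res_d 0%N) g.
Proof.
have [_ fgE _] := fg; move=> b; rewrite fgE.
split=> [[k <-]|[x <-]]; last by exists (res_aug P x).
by have [x <-] := @res_aug_surj _ _ P k; exists x.
Qed.

Fact cons_res_exact i : exact (cons_res_d i.+1) (cons_res_d i).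
Proof.
case: i => [|i]; last exact: res_exact.
have [f_inj _ _] := fg; move=> x; rewrite -(@res_exact0 _ _ P x).
split=> [/=|/= ->]; last exact: raddf0.
by rewrite -[X in _ = X](raddf0 f) => /f_inj.
Qed.

Definition cons_res : resolution A :=
  @Resolution R A cons_res_obj cons_res_d g
    (let: And3 _ _ g_surj := fg in g_surj) cons_res_exact0 cons_res_exact.
End Cons.

Section CoCons.
Variable Q : coresolution A.

Definition cons_cores_obj (i : nat) : lmodType R := if i is j.+1 then Q j else B.
Definition cons_cores_d i : {linear cons_cores_obj i -> cons_cores_obj i.+1} :=
  match i with 0%N => cores_aug Q \o g | j.+1 => cores_d Q j end.

Fact cons_cores_exact0 : exact f (cons_cores_d 0%N).
Proof.
have [_ fgE _] := fg; move=> b; rewrite -fgE /=.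
split=> [|->]; last exact: raddf0.
by rewrite -[X in _ = X](raddf0 (cores_aug Q)) => /(@cores_aug_inj _ _ Q).
Qed.

Fact cons_cores_exact i : exact (cons_cores_d i) (cons_cores_d i.+1).
Proof.
case: i => [|i]; last exact: cores_exact.
have [_ _ g_surj] := fg; move=> x; rewrite (@cores_exact0 _ _ Q x).
split=> [[a <-]|[b <-]]; last by exists (g b).
by have [b <-] := g_surj a; exists b.
Qed.

Definition cons_cores : coresolution K :=
  @Coresolution R K cons_cores_obj cons_cores_d f
    (let: And3 f_inj _ _ := fg in f_inj) cons_cores_exact0 cons_cores_exact.
End CoCons.
End Prepend.

Section Tail.
Variables (A : lmodType R) (P : resolution A).

Fact tail_aug_ker x : res_aug P (res_d P 0%N x) = 0.
Proof. by apply/(@res_exact0 _ _ P); exists x. Qed.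

Fact tail_aug_linear : linear (fun x => to_ker (tail_aug_ker x)).
Proof. by move=> r x y; apply: val_inj; rewrite /= linearP. Qed.

Definition tail_aug : {linear P 1%N -> ker (res_aug P)} := mklin tail_aug_linear.

Fact tail_aug_surj : surjective tail_aug.
Proof.
move=> k; have [x xk] := (@res_exact0 _ _ P (\val k)).1 (kerP k).
by exists x; apply: val_inj.
Qed.

Fact tail_exact0 : exact (res_d P 1%N) tail_aug.
Proof.
move=> x; rewrite -(@res_exact _ _ P 0%N x); split=> [/(congr1 \val)//|dx].
exact: val_inj.
Qed.

Definition tail_res : resolution (ker (res_aug P)) :=
  @Resolution R (ker (res_aug P)) (fun i => P i.+1) (fun i => res_d P i.+1)
    tail_aug tail_aug_surj tail_exact0 (fun i => @res_exact R A P i.+1).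

End Tail.

(** The inverse operation of splicing. Only the objects of the new coresolution
    matter for finite coresolution dimension. *)
Lemma tail_cores A (Q : coresolution A) :
  exists Q' : coresolution (coker (cores_aug Q)), forall i, Q' i = Q i.+1.
Proof.
have [h hp] : exists h : {linear coker (cores_aug Q) -> Q 1%N},
    forall b, h (coker_proj _ b) = cores_d Q 0%N b.
  apply: factor_surj => [|b /coker_proj_eq0 ?]; first exact: coker_proj_surj.
  exact/(@cores_exact0 _ _ Q).
have h_inj : injective h.
  apply: raddf_inj => c; have [b <-] := coker_proj_surj c.
  rewrite /= hp => /(@cores_exact0 _ _ Q) ?.
  exact/coker_proj_eq0.
have h_ex : exact h (cores_d Q 1%N).
  move=> x; rewrite (@cores_exact _ _ Q 0%N x).
  split=> [[b <-]|[c <-]]; first by exists (coker_proj _ b).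
  by have [b <-] := coker_proj_surj c; exists b; rewrite -hp.
by exists (@Coresolution R _ (fun i => Q i.+1) (fun i => cores_d Q i.+1)
  h h_inj h_ex (fun i => @cores_exact R A Q i.+1)).
Qed.

Definition zero_mod : lmodType R := ker (idfun : R^o -> R^o).

Lemma zero_modP (x : zero_mod) : x = 0.
Proof. exact/val_inj/(kerP x). Qed.

Lemma zero_mod_exact A B (f : {linear A -> zero_mod}) (g : {linear zero_mod -> B}) :
  exact f g.
Proof.
move=> x; rewrite (zero_modP x); split=> _; last exact: raddf0.
by exists 0; rewrite raddf0.
Qed.

Fact null_linear A B : linear (fun _ : A => 0 : B).
Proof. by move=> r x y; rewrite scaler0 addr0. Qed.
Definition null_lin A B : {linear A -> B} := mklin (@null_linear A B).

Definition zero_res : resolution zero_mod.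
Proof.
apply: (@Resolution R zero_mod (fun=> zero_mod) (fun=> null_lin _ _) (null_lin _ _)).
- by move=> x; exists 0; rewrite (zero_modP x).
- exact: zero_mod_exact.
- by move=> i; apply: zero_mod_exact.
Defined.

Definition zero_cores : coresolution zero_mod.
Proof.
apply: (@Coresolution R zero_mod (fun=> zero_mod) (fun=> null_lin _ _) (null_lin _ _)).
- by move=> x y _; rewrite (zero_modP x) (zero_modP y).
- exact: zero_mod_exact.
- by move=> i; apply: zero_mod_exact.
Defined.

Lemma id_short_exactl A : short_exact (null_lin zero_mod A) (idfun : A -> A).
Proof.
split=> [x y _|a|a]; first by rewrite (zero_modP x) (zero_modP y).
  by split=> [a0|[x xa]]; [exists 0; apply: esym a0 | apply: esym xa].
by exists a.
Qed.

Lemma id_short_exactr A : short_exact (idfun : A -> A) (null_lin A zero_mod).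
Proof.
split=> [//|a|x]; first by split=> // _; exists a.
by exists 0; rewrite (zero_modP x).
Qed.

(** The classes [wedge] and [vee] built one short exact sequence at a time, the
    form in which every induction on finite (co)resolutions is made. *)
Inductive res_dim (C : lmodType R -> Prop) : nat -> lmodType R -> Prop :=
| ResDim0 m A : C A -> res_dim C m A
| ResDimS m A B K (f : {linear K -> B}) (g : {linear B -> A}) :
    short_exact f g -> C B -> res_dim C m K -> res_dim C m.+1 A.

Inductive cores_dim (C : lmodType R -> Prop) : nat -> lmodType R -> Prop :=
| CoresDim0 m A : C A -> cores_dim C m A
| CoresDimS m A B K (f : {linear A -> B}) (g : {linear B -> K}) :
    short_exact f g -> C B -> cores_dim C m K -> cores_dim C m.+1 A.

Lemma wedgeP (C : modclass R) m A : wedge C m A <-> res_dim C m A.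
Proof.
split=> [[k [P [km CP P0]]]|].
  elim: k m A P km CP P0 => [|k IHk] m A P km CP P0.
    have aug_inj : injective (res_aug P).
      apply: raddf_inj => x /(@res_exact0 _ _ P)[y <-].
      by rewrite (P0 1%N isT y) raddf0.
    have [s sK] := choice (@res_aug_surj _ _ P).
    have aug_bij : bijective (res_aug P) by exists s => // x; apply: aug_inj.
    by apply: ResDim0; apply: class_iso aug_bij (CP 0%N _).
  case: m km => // m km.
  apply: (ResDimS (ker_short_exact (@res_aug_surj _ _ P)) (CP 0%N _)) => //.
  by apply: (IHk m _ (tail_res P)) => // i ik; [apply: CP | apply: P0].
elim=> {m A} [m A CA|m A B K f g fg CB _ [k [P [km CP P0]]]].
  exists 0%N, (cons_res (id_short_exactl A) zero_res); split=> //.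
    by case.
  by case=> // i _ x; apply: zero_modP.
exists k.+1, (cons_res fg P); split=> // -[|i] //; [exact: CP | exact: P0].
Qed.

Lemma veeP (C : modclass R) m A : vee C m A <-> cores_dim C m A.
Proof.
split=> [[k [Q [km CQ Q0]]]|].
  elim: k m A Q km CQ Q0 => [|k IHk] m A Q km CQ Q0.
    have [s sK] := choice (fun y => (@cores_exact0 _ _ Q y).1 (Q0 1%N isT _)).
    have aug_bij : bijective (cores_aug Q).
      by exists s => // x; apply: (@cores_aug_inj _ _ Q).
    have [h [hK augK]] := linear_inverse aug_bij.
    have h_bij : bijective h by exists (cores_aug Q).
    by apply: CoresDim0; apply: class_iso h_bij (CQ 0%N _).
  case: m km => // m km.
  have [Q' Q'E] := tail_cores Q.
  apply: (CoresDimS (coker_short_exact (@cores_aug_inj _ _ Q)) (CQ 0%N _)) => //.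
  by apply: (IHk m _ Q') => // i ik; rewrite Q'E; [apply: CQ | apply: Q0].
elim=> {m A} [m A CA|m A B K f g fg CB _ [k [Q [km CQ Q0]]]].
  exists 0%N, (cons_cores (id_short_exactr A) zero_cores); split=> //.
    by case.
  by case=> // i _ x; apply: zero_modP.
exists k.+1, (cons_cores fg Q); split=> // -[|i] //; [exact: CQ | exact: Q0].
Qed.

End Resolutions.

(** * Dimension shifting *)

Section ExactTools.
Variable R : pzRingType.

(** The pullback square is symmetric: [v] is the base change of [u] along [g],
    and so has the kernel of [u]. The square is arbitrary rather than the one
    built in [pullback], whose construction is hidden by an existential; the two
    short exact sequences are enough to recover the universal property of W. *)
Lemma pullback_kernel (A B C C' W L : lmodType R)
    (f : {linear A -> B}) (g : {linear B -> C}) (u : {linear C' -> C})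
    (f' : {linear A -> W}) (g' : {linear W -> C'}) (v : {linear W -> B})
    (k : {linear L -> C'}) :
  short_exact f g -> short_exact f' g' -> (forall a, v (f' a) = f a) ->
  (forall e, g (v e) = u (g' e)) -> short_exact k u ->
  exists k' : {linear L -> W}, short_exact k' v /\ forall l, g' (k' l) = k l.
Proof.
move=> [f_inj fg g_surj] fg' vf gv [k_inj ku u_surj].
have [_ fg'E g'_surj] := fg'.
have lift b c : g b = u c -> exists e, v e = b /\ g' e = c.
  move=> gbuc; have [e0 g'e0] := g'_surj c.
  have /fg[a fa] : g (b - v e0) = 0 by rewrite raddfB /= gv g'e0 gbuc subrr.
  exists (e0 + f' a); rewrite !raddfD /= vf fa g'e0 (short_exact_comp0 _ fg') addr0.
  by rewrite addrC subrK.
have vg'_lin : linear (fun e => (v e, g' e) : (B * C')%type).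
  by move=> r x y; rewrite !linearP.
have vg'_inj : injective (mklin vg'_lin).
  apply: raddf_inj => e /= [ve g'e].
  have [a ae] := (fg'E e).1 g'e.
  by move: ve; rewrite -ae vf -[RHS](raddf0 f) => /f_inj ->; rewrite raddf0.
have [k' k'E] : exists k' : {linear L -> W},
    forall l, mklin vg'_lin (k' l) = (inr_lin B C' \o k) l.
  apply: factor_inj => // l /=.
  have [|e [ve g'e]] := lift 0 (k l); last by exists e; rewrite ve g'e.
  by rewrite raddf0; apply/esym/ku; exists l.
have vk' l : v (k' l) = 0 by have [] := k'E l.
have g'k' l : g' (k' l) = k l by have [] := k'E l.
exists k'; split=> //; split=> [x y /(congr1 g')|e|b].
- by rewrite !g'k' => /k_inj.
- split=> [ve|[l <-]//].
  have /ku[l kl] : u (g' e) = 0 by rewrite -gv ve raddf0.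
  by exists l; apply: vg'_inj; rewrite /= vk' g'k' ve kl.
have [c uc] := u_surj (g b).
by have [|e [ve _]] := lift b c; [rewrite uc | exists e].
Qed.

(** For an extension B of C by A and an epimorphism P -> B with kernel K, the
    kernel of P -> C is an extension of A by K. Properties of the inclusion
    K -> P can thus be checked in two steps, one for A and one for C. *)
Lemma ker_comp_short_exact (A B C K P : lmodType R)
    (f : {linear K -> P}) (g : {linear P -> B})
    (j : {linear A -> B}) (q : {linear B -> C}) :
  short_exact f g -> short_exact j q ->
  exists (f' : {linear K -> ker (q \o g)}) (g' : {linear ker (q \o g) -> A}),
    [/\ short_exact f' g', forall k, \val (f' k) = f k
      & short_exact (\val : ker (q \o g) -> P) (q \o g)].
Proof.
move=> fg jq; have [f_inj fgE g_surj] := fg; have [j_inj jqE q_surj] := jq.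
have [f' f'E] : exists f' : {linear K -> ker (q \o g)}, forall k, \val (f' k) = f k.
  apply: (factor_inj (f := \val : ker (q \o g) -> P)); first exact: val_inj.
  move=> k; have fk : (q \o g) (f k) = 0 by rewrite /= (short_exact_comp0 _ fg) raddf0.
  by exists (to_ker fk).
have [g' jg'] : exists g' : {linear ker (q \o g) -> A},
    forall x, j (g' x) = (g \o (\val : ker (q \o g) -> P)) x.
  by apply: factor_inj => // x; apply/jqE/(kerP x).
exists f', g'; split=> //; last first.
  apply: ker_short_exact => c; have [b <-] := q_surj c.
  by have [x <-] := g_surj b; exists x.
split=> [x y /(congr1 \val)|x|a]; first by rewrite !f'E => /f_inj.
  split=> [g'x|[k <-]].
    have /fgE[k fk] : g (\val x) = 0 by rewrite -[LHS]jg' g'x raddf0.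
    by exists k; apply: val_inj; rewrite f'E.
  by apply: j_inj; rewrite jg' /= f'E (short_exact_comp0 _ fg) raddf0.
have [x gx] := g_surj (j a).
have xP : (q \o g) x = 0 by rewrite /= gx (short_exact_comp0 _ jq).
by exists (to_ker xP); apply: j_inj; rewrite jg'.
Qed.

Lemma projective_prod (P Q : lmodType R) :
  projective P -> projective Q -> projective (P * Q)%type.
Proof.
move=> P_proj Q_proj A B g f g_surj.
have [h gh] := P_proj _ _ g (f \o inl_lin P Q) g_surj.
have [k gk] := Q_proj _ _ g (f \o inr_lin P Q) g_surj.
have hk_lin : linear (fun x : (P * Q)%type => h x.1 + k x.2).
  by move=> r x y; rewrite /= !linearP addrACA -scalerDr.
exists (mklin hk_lin) => -[x y]; rewrite /= raddfD /= gh gk /= -raddfD.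
by congr (f (_, _)); rewrite /= ?addr0 ?add0r.
Qed.

Lemma cover_short_exact (A : lmodType R) :
  short_exact (\val : ker (cover A) -> free_mod R A) (cover A).
Proof. exact/ker_short_exact/cover_surj. Qed.

End ExactTools.

Section DimensionShift.
Variables (R : pzRingType) (T : nat -> lmodType R -> Prop).
Implicit Types A B K P Q X : lmodType R.

Definition closed_retracts (C : lmodType R -> Prop) :=
  forall (A B : lmodType R) (i : {linear A -> B}) (p : {linear B -> A}),
    cancel i p -> C B -> C A.

(** The recursion common to Ext^(i+1)(-, B) = 0 and Tor_(i+1)(M, -) = 0: a
    module has the property of level i+1 when all its first syzygies have that
    of level i. *)
Definition dimension_shifting := forall i A,
  T i.+1 A <-> (forall K P (f : {linear K -> P}) (g : {linear P -> A}),
                  short_exact f g -> projective P -> T i K).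

Hypothesis TS : dimension_shifting.
Hypotheses (T0_ext : closed_extensions (T 0%N)) (T0_retract : closed_retracts (T 0%N)).
Hypothesis T0_proj : forall P, projective P -> T 0%N P.

(** The part T_(i+1)(X), T_i(K), T_i(Q) of a long exact sequence, without
    connecting maps. The pullback W of a projective cover of X along Q -> X is
    an extension of Q by a syzygy of X, so it has the property of level i; and K
    is a direct summand of W, since W -> P is onto a projective module. *)
Fact shift_kernel_step i : closed_extensions (T i) -> closed_retracts (T i) ->
  forall K Q X (f : {linear K -> Q}) (g : {linear Q -> X}),
    short_exact f g -> T i Q -> T i.+1 X -> T i K.
Proof.
move=> T_ext T_retract K Q X f g fg TQ /TS TX.
have F_proj := @free_projective R X.
have [W [f' [g' [v [fg' vf gv]]]]] := pullback (cover X) fg.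
have [k' [k'v _]] := pullback_kernel fg fg' vf gv (cover_short_exact X).
have TW : T i W := T_ext _ _ _ _ _ k'v (TX _ _ _ _ (cover_short_exact X) F_proj) TQ.
have [_ _ g'_surj] := fg'.
have [s g's] := projective_section F_proj g'_surj.
have [p pf'] := retraction_of_section fg' g's.
exact: T_retract pf' TW.
Qed.

(** The three closure properties are proved together: the one for extensions at
    level i+1 needs [shift_kernel_step] at level i, which needs all of them at
    level i. *)
Lemma shift_closed i : [/\ closed_extensions (T i), closed_retracts (T i)
  & forall P, projective P -> T i P].
Proof.
elim: i => [//|i [T_ext T_retract T_proj]]; split.
- move=> A' A'' A j q jq TA' TA''; apply/TS => K P f g fg P_proj.
  have [f' [g' [fg' _ kq]]] := ker_comp_short_exact fg jq.
  apply: (shift_kernel_step T_ext T_retract fg') TA'.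
  by move/TS: TA'' => /(_ _ _ _ _ kq P_proj).
- move=> A B j p pj TB; apply/TS => K P f g fg P_proj.
  have [f_inj fgE g_surj] := fg.
  have h_lin : linear (fun x : (P * free_mod R (ker p))%type =>
      j (g x.1) + \val (cover (ker p) x.2)).
    by move=> r x y; rewrite /= !linearP addrACA -scalerDr.
  pose h := mklin h_lin.
  have h_surj : surjective h.
    move=> b; have [x gx] := g_surj (p b).
    have bP : p (b - j (p b)) = 0 by rewrite raddfB /= pj subrr.
    have [y yb] := @cover_surj R _ (to_ker bP).
    by exists (x, y); rewrite /= gx yb addrC subrK.
  (* K is a summand of the kernel of h, where h presents B = A + ker p *)
  have TN : T i (ker h).
    have PF := projective_prod P_proj (@free_projective R (ker p)).
    by move/TS: TB => /(_ _ _ _ _ (ker_short_exact h_surj) PF).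
  have hP k : h (f k, 0) = 0.
    by rewrite /= (short_exact_comp0 _ fg) !raddf0 addr0.
  have k_lin : linear (fun k => to_ker (hP k)).
    by move=> r x y; apply: val_inj; congr (_, _); rewrite /= ?linearP // scaler0 addr0.
  have n_lin : linear (fun n : ker h => (\val n).1) by [].
  have [r fr] : exists r : {linear ker h -> K}, forall n, f (r n) = mklin n_lin n.
    apply: factor_inj => // n; apply/fgE.
    have := congr1 p (kerP n); rewrite raddf0 /= raddfD /= pj => <-.
    by rewrite kerP addr0.
  by apply: (T_retract _ _ (mklin k_lin) r) TN => k; apply: f_inj; rewrite fr.
- move=> Q Q_proj; apply/TS => K P f g fg P_proj.
  have [_ _ g_surj] := fg.
  have [s gs] := projective_section Q_proj g_surj.
  have [p pf] := retraction_of_section fg gs.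
  exact: T_retract pf (T_proj _ P_proj).
Qed.

Lemma shift_kernel i K Q X (f : {linear K -> Q}) (g : {linear Q -> X}) :
  short_exact f g -> T i Q -> T i.+1 X -> T i K.
Proof. by have [? ? _] := shift_closed i; apply: shift_kernel_step. Qed.

(** Schanuel: any two first syzygies of A become isomorphic after adding
    projectives, so one of them decides for all. *)
Lemma shift_of_presentation i K P A (f : {linear K -> P}) (g : {linear P -> A}) :
  short_exact f g -> projective P -> T i K -> T i.+1 A.
Proof.
move=> fg P_proj TK; apply/TS => K' P' f' g' fg' P'_proj.
have [T_ext T_retract T_proj] := shift_closed i.
have [W [k [q [v [kq vk gv]]]]] := pullback g' fg.
have [k' [k'v _]] := pullback_kernel fg kq vk gv fg'.
have TW : T i W := T_ext _ _ _ _ _ kq TK (T_proj _ P'_proj).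
have [_ _ v_surj] := k'v.
have [s vs] := projective_section P_proj v_surj.
have [p pk'] := retraction_of_section k'v vs.
exact: T_retract pk' TW.
Qed.

End DimensionShift.

(** * Vanishing of Ext *)

Section ExtShift.
Variables (R : pzRingType) (B : lmodType R).
Implicit Types A K P : lmodType R.

Lemma Ext_zero1P A : Ext_zero 1 A B <-> ext1 A B.
Proof.
split=> [extA|extA P _ f fd].
  apply: (ext1_of_presentation (cover_short_exact A)) => [|u].
    exact: free_projective.
  have [|g gE] := extA (std_resolution A) (fun j => @free_projective R _)
    (u \o cover (syzygy A 1)).
    by move=> x; rewrite /= (kerP (cover _ x)) raddf0.
  exists g => k; have [x <-] := @cover_surj R (syzygy A 1) k.
  exact/esym/gE.
have [u uE] : exists u : {linear ker (res_aug P) -> B}, forall x, u (tail_aug P x) = f x.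
  apply: factor_surj => [|x /(tail_exact0 x)[y <-]]; [exact: tail_aug_surj | exact: fd].
have [g gE] := extA _ _ _ _ (ker_short_exact (@res_aug_surj _ _ P)) u.
by exists g => x; rewrite -uE -gE.
Qed.

Lemma Ext_zero_shift : dimension_shifting (fun i A => Ext_zero i.+1 A B).
Proof.
move=> i A; split=> [extA K P f g fg P_proj Q Q_proj|extK P P_proj].
  by apply: (extA (cons_res fg Q)); case.
exact: (extK _ _ _ _ (ker_short_exact (@res_aug_surj _ _ P)) (P_proj 0%N)
  (tail_res P) (fun j => P_proj j.+1)).
Qed.

Lemma ext1_closed_extensions : closed_extensions (fun A => ext1 A B).
Proof.
move=> A' A'' A j q jq extA' extA'' K P f g fg u.
have [f' [g' [fg' f'E kq]]] := ker_comp_short_exact fg jq.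
have [v vf'] := extA' _ _ _ _ fg' u.
have [w wE] := extA'' _ _ _ _ kq v.
by exists w => k; rewrite -f'E wE.
Qed.

Lemma projective_ext1 P : projective P -> ext1 P B.
Proof.
move=> P_proj; apply: ext1_of_sections => E f g [_ _ g_surj].
exact: projective_section.
Qed.

Lemma Ext_zero1_ext : closed_extensions (fun A => Ext_zero 1 A B).
Proof.
by move=> A' A'' A j q jq /Ext_zero1P A'B /Ext_zero1P A''B; apply/Ext_zero1P;
   apply: ext1_closed_extensions jq _ _.
Qed.

Lemma Ext_zero1_retract : closed_retracts (fun A => Ext_zero 1 A B).
Proof.
move=> A' A i p pi /Ext_zero1P AB; apply/Ext_zero1P.
exact: (ext1_retract (i' := idfun) (p' := idfun) pi _ AB).
Qed.

Lemma Ext_zero1_projective P : projective P -> Ext_zero 1 P B.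
Proof. by move=> P_proj; apply/Ext_zero1P/projective_ext1. Qed.

Lemma Ext_zero_of_presentation i K P A (f : {linear K -> P}) (g : {linear P -> A}) :
  short_exact f g -> projective P -> Ext_zero i.+1 K B -> Ext_zero i.+2 A B.
Proof.
exact: (shift_of_presentation Ext_zero_shift Ext_zero1_ext Ext_zero1_retract
  Ext_zero1_projective).
Qed.

Lemma Ext_zero_retract i : closed_retracts (fun A => Ext_zero i.+1 A B).
Proof.
by have [_ H _] := shift_closed Ext_zero_shift Ext_zero1_ext Ext_zero1_retract
  Ext_zero1_projective i.
Qed.

End ExtShift.

(** * Right exactness of the tensor product, and vanishing of Tor *)

Section TensorExact.
Variables (R : pzRingType) (M : bimod R).
Implicit Types A B C K P : lmodType R.

Lemma tens_map_comp A B C (f : {linear A -> B}) (g : {linear B -> C}) t :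
  tens_map M g (tens_map M f t) = tens_map M (g \o f) t.
Proof.
apply: (@tens_ext _ _ _ _ (tens_map M g \o tens_map M f) (tens_map M (g \o f))).
by move=> m x; rewrite /= !tens_mapE.
Qed.

Lemma eq_tens_map A B (f g : {linear A -> B}) :
  f =1 g -> tens_map M f =1 tens_map M g.
Proof. by move=> fg; apply: tens_ext => m x; rewrite /= ?tens_mapE fg. Qed.

Lemma tens_map_id A (f : {linear A -> A}) : f =1 id -> tens_map M f =1 id.
Proof.
by move=> f_id; apply: (@tens_ext _ _ _ _ (tens_map M f) idfun) => m x;
   rewrite /= tens_mapE f_id.
Qed.

Lemma tens_map_null A B (f : {linear A -> B}) :
  (forall a, f a = 0) -> forall t, tens_map M f t = 0.
Proof.
move=> f0; apply: (@tens_ext _ _ _ _ (tens_map M f) (null_lin _ _)) => m x.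
by rewrite /= tens_mapE f0; apply: (addrI (tensor m 0)); rewrite -tensorDr !addr0.
Qed.

Lemma tens_map_surj A B (g : {linear A -> B}) : surjective g -> surjective (tens_map M g).
Proof.
move=> g_surj; elim/tens_ind => [|m x t [s <-]|t [s <-]|t t' [s <-] [s' <-]].
- by exists 0; rewrite raddf0.
- have [y <-] := g_surj x.
  by exists (tensor m y + s); rewrite raddfD /= tens_mapE.
- by exists (- s); rewrite raddfN.
- by exists (s + s'); rewrite raddfD.
Qed.

(** The inverse of coker (M (x) f) -> M (x) C sends m (x) x to the class of
    m (x) s x for a set-theoretic section s of g; s is additive and R-linear only
    modulo the image of f, whence the cokernel as target. *)
Lemma tens_right_exact A B C (f : {linear A -> B}) (g : {linear B -> C}) :
  exact f g -> surjective g -> exact (tens_map M f) (tens_map M g).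
Proof.
move=> fg g_surj t; split=> [gt|[s <-]]; last first.
  by rewrite /= tens_map_comp; apply: tens_map_null => a; apply/fg; exists a.
have [s sK] := choice g_surj.
pose c : {linear tens M B -> coker (tens_map M f)} := coker_proj (tens_map M f).
have cE m b b' : g b = g b' -> c (tensor m b) = c (tensor m b').
  move=> gb; apply/to_cokerP; have /fg[a fa] : g (b - b') = 0 by rewrite raddfB /= gb subrr.
  exists (tensor m a); rewrite /= tens_mapE fa; apply: (addIr (tensor m b')).
  by rewrite -tensorDr !subrK.
have bDl m m' x : c (tensor (m + m') (s x)) = c (tensor m (s x)) + c (tensor m' (s x)).
  by rewrite tensorDl raddfD.
have bDr m x x' : c (tensor m (s (x + x'))) = c (tensor m (s x)) + c (tensor m (s x')).
  by rewrite -raddfD /= -tensorDr; apply: cE; rewrite raddfD /= !sK.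
have b_bal m r x : c (tensor (rscale m r) (s x)) = c (tensor m (s (r *: x))).
  by rewrite tensor_bal; apply: cE; rewrite linearZ /= !sK.
pose b := Balanced bDl bDr b_bal.
suff /(_ t) : c =1 (tens_lift b \o tens_map M g) :> (tens M B -> _).
  by rewrite /= gt raddf0 => /coker_proj_eq0.
apply: tens_ext => m x; rewrite /= tens_mapE tens_liftE /=; apply: cE.
by rewrite sK.
Qed.

(** The vanishing of Tor_1(M, A). *)
Definition tor1 A : Prop :=
  forall K P (f : {linear K -> P}) (g : {linear P -> A}),
    short_exact f g -> injective (tens_map M f).

Lemma tens_short_exact A B C (f : {linear A -> B}) (g : {linear B -> C}) :
  tor1 C -> short_exact f g -> short_exact (tens_map M f) (tens_map M g).
Proof.
move=> torC fg; split; first exact: torC fg.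
  by case: fg => _ ? ?; apply: tens_right_exact.
by case: fg => _ _ ?; apply: tens_map_surj.
Qed.

Lemma tens_map_split_inj A B (f : {linear A -> B}) (p : {linear B -> A}) :
  cancel f p -> injective (tens_map M f).
Proof.
move=> pf; apply: (can_inj (g := tens_map M p)) => t.
by rewrite /= tens_map_comp tens_map_id.
Qed.

(** Compare K' -> P' with the given presentation through the pullback W of P and
    P' over A. An element killed in M (x) P' comes, once seen in M (x) W, from
    M (x) K, and its image in M (x) P is zero; there injectivity is known. Seeing
    it in M (x) W loses nothing, as K' -> W splits. *)
Lemma tor1_of_presentation A K P (f : {linear K -> P}) (g : {linear P -> A}) :
  short_exact f g -> projective P -> injective (tens_map M f) -> tor1 A.
Proof.
move=> fg P_proj f_inj K' P' f' g' fg'.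
have [W [k [q [v [kq vk g'v]]]]] := pullback g fg'.
have [k' [k'v qk']] := pullback_kernel fg' kq vk g'v fg.
have [_ _ q_surj] := kq.
have [s qs] := projective_section P_proj q_surj.
have [p pk] := retraction_of_section kq qs.
apply: raddf_inj => t /= f't.
apply: (tens_map_split_inj pk); rewrite raddf0.
have : tens_map M v (tens_map M k t) = 0.
  by rewrite /= tens_map_comp (eq_tens_map (g := f')).
have [_ k'vE v_surj] := k'v.
move/(tens_right_exact k'vE v_surj) => [x xk]; rewrite -xk.
suff -> : x = 0 by rewrite raddf0.
apply: f_inj; rewrite raddf0 -(eq_tens_map (f := q \o k')) // -tens_map_comp xk.
by rewrite /= tens_map_comp; apply: tens_map_null => y; apply: short_exact_comp0 kq.
Qed.
End TensorExact.

Section TorShift.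
Variables (R : pzRingType) (M : bimod R).
Implicit Types A B K P Q X : lmodType R.

Lemma Tor_zero1P A : Tor_zero 1 M A <-> tor1 M A.
Proof.
split=> [torA|torA P _ t].
  apply: (tor1_of_presentation (cover_short_exact A)); first exact: free_projective.
  have := torA (std_resolution A) (fun j => @free_projective R _).
  move=> /= torE; apply: raddf_inj => s /=.
  have [t <-] := tens_map_surj (@cover_surj R (syzygy A 1)) s.
  rewrite /= tens_map_comp => /torE[x <-] /=.
  rewrite tens_map_comp; apply: tens_map_null => y.
  exact: (kerP (cover (syzygy A 2) y)).
split=> [|[s <-]]; last first.
  rewrite /= tens_map_comp; apply: tens_map_null => x.
  by apply/(@res_exact _ _ P 0%N); exists x.
move=> dt0.
have : tens_map M (\val : ker (res_aug P) -> P 0%N) (tens_map M (tail_aug P) t) = 0.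
  by rewrite tens_map_comp -[RHS]dt0; apply: eq_tens_map.
rewrite -[X in _ = X](raddf0 (tens_map M (\val : ker (res_aug P) -> P 0%N))).
move/(torA _ _ _ _ (ker_short_exact (@res_aug_surj _ _ P))).
exact: (tens_right_exact (@tail_exact0 _ _ P) (@tail_aug_surj _ _ P) t).1.
Qed.

Lemma Tor_zero_shift : dimension_shifting (fun i A => Tor_zero i.+1 M A).
Proof.
move=> i A; split=> [torA K P f g fg P_proj Q Q_proj|torK P P_proj].
  by apply: (torA (cons_res fg Q)); case.
exact: (torK _ _ _ _ (ker_short_exact (@res_aug_surj _ _ P)) (P_proj 0%N)
  (tail_res P) (fun j => P_proj j.+1)).
Qed.

Lemma Tor_zero1_ext : closed_extensions (fun A => Tor_zero 1 M A).
Proof.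
move=> A' A'' A j q jq /Tor_zero1P torA' /Tor_zero1P torA''; apply/Tor_zero1P.
move=> K P f g fg.
have [f' [g' [fg' f'E kq]]] := ker_comp_short_exact fg jq.
have f'_inj := torA' _ _ _ _ fg'; have k_inj := torA'' _ _ _ _ kq.
have fE t : tens_map M f t = tens_map M (\val : ker (q \o g) -> P) (tens_map M f' t).
  by rewrite tens_map_comp; apply: eq_tens_map => k; rewrite /= f'E.
by move=> s t; rewrite !fE => /k_inj/f'_inj.
Qed.

(** A presentation of A is completed to one of B by adding the complement ker p
    of A to the middle term only, which leaves the kernel K unchanged. *)
Lemma Tor_zero1_retract : closed_retracts (fun A => Tor_zero 1 M A).
Proof.
move=> A B i p pi /Tor_zero1P torB; apply/Tor_zero1P => K P f g fg.
have [f_inj fgE g_surj] := fg.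
have h_lin : linear (fun x : (P * ker p)%type => i (g x.1) + \val x.2).
  by move=> r x y; rewrite /= !linearP addrACA -scalerDr.
have fh : short_exact (inl_lin P (ker p) \o f) (mklin h_lin).
  split=> [x y [/f_inj]//|[x a]|b] /=.
    split=> [xa|[k [<- <-]]]; last by rewrite (short_exact_comp0 _ fg) !raddf0 addr0.
    have gx : g x = 0.
      by have := congr1 p xa; rewrite raddfD /= pi kerP addr0 raddf0.
    have [k fk] := (fgE x).1 gx; exists k; congr (_, _); rewrite //.
    by apply: val_inj; rewrite -[RHS]add0r -[X in X + _](raddf0 i) -gx xa.
  have [x gx] := g_surj (p b).
  have bP : p (b - i (p b)) = 0 by rewrite raddfB /= pi subrr.
  by exists (x, to_ker bP); rewrite /= gx addrC subrK.
move=> s t st; apply: (torB _ _ _ _ fh).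
by rewrite -!(tens_map_comp f (inl_lin P (ker p))) st.
Qed.

Lemma Tor_zero1_projective P : projective P -> Tor_zero 1 M P.
Proof.
move=> P_proj; apply/Tor_zero1P => K Q f g fg; have [_ _ g_surj] := fg.
have [s gs] := projective_section P_proj g_surj.
have [p pf] := retraction_of_section fg gs.
exact: tens_map_split_inj pf.
Qed.

Lemma Tor_zero_kernel i K Q X (f : {linear K -> Q}) (g : {linear Q -> X}) :
  short_exact f g -> Tor_zero i.+1 M Q -> Tor_zero i.+2 M X -> Tor_zero i.+1 M K.
Proof.
exact: (shift_kernel Tor_zero_shift Tor_zero1_ext Tor_zero1_retract
  Tor_zero1_projective).
Qed.

(** Each step of a C-coresolution of A costs one degree of Tor. *)
Lemma Tor_zero_cores_dim (C : lmodType R -> Prop) n :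
  (forall i A, (1 <= i <= n)%N -> C A -> Tor_zero i M A) ->
  forall m A i, cores_dim C m A -> (i + m < n)%N -> Tor_zero i.+1 M A.
Proof.
move=> torC m A i CA; elim: CA i => {m A} [m A CA|m A B K f g fg CB _ IH] i lt_n.
  by apply: torC CA; rewrite /= (leq_trans _ lt_n) // ltnS leq_addr.
apply: (Tor_zero_kernel fg); last by apply: IH; rewrite addSnnS.
by apply: torC CB; rewrite /= (leq_trans _ lt_n) // ltnS leq_addr.
Qed.

Lemma tor1_cores_dim (C : lmodType R -> Prop) n m A :
  (forall i A, (1 <= i <= n)%N -> C A -> Tor_zero i M A) ->
  cores_dim C m A -> (m < n)%N -> tor1 M A.
Proof. by move=> torC CA m_lt; apply/Tor_zero1P/(Tor_zero_cores_dim torC CA). Qed.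

End TorShift.

(** * Classes of modules *)

Section ClassTools.
Variable R : pzRingType.
Implicit Types A B K : lmodType R.

Lemma closed_summands_retracts (C : modclass R) :
  closed_summands C -> closed_retracts C.
Proof.
move=> C_summ A B i p pi CB; apply: (C_summ A (ker p)).
have kP b : p (b - i (p b)) = 0 by rewrite raddfB /= pi subrr.
have h_lin : linear (fun b => (p b, to_ker (kP b)) : (A * ker p)%type).
  move=> r x y; apply: injective_projections; rewrite /= ?linearP //.
  by apply: val_inj; rewrite /= !linearP addrACA -scalerDr.
have h_bij : bijective (mklin h_lin).
  exists (fun x => i x.1 + \val x.2) => [b|[a k]] /=; first by rewrite addrC subrK.
  have pk : p (i a + \val k) = a by rewrite raddfD /= pi kerP addr0.
  apply: injective_projections; rewrite /= ?pk //.
  by apply: val_inj; rewrite /= pk addrAC subrr add0r.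
exact: class_iso h_bij CB.
Qed.

Lemma res_dim_iso (C : modclass R) m A B (h : {linear A -> B}) :
  bijective h -> res_dim C m A -> res_dim C m B.
Proof.
move=> h_bij CA; case: CA h h_bij => {m A} [m A CA|m A E K f g fg CE CK] h h_bij.
  by apply: ResDim0; apply: class_iso h_bij CA.
have [f_inj fgE g_surj] := fg; have [h' hK h'K] := h_bij.
apply: (@ResDimS _ _ m B E K f (h \o g)) => //; split=> // [x|b].
  rewrite -fgE /= -[X in _ = X](raddf0 h); split=> [|->//].
  exact: (can_inj hK).
by have [x gx] := g_surj (h' b); exists x; rewrite /= gx h'K.
Qed.

Lemma cores_dim_iso (C : modclass R) m A B (h : {linear B -> A}) :
  bijective h -> cores_dim C m A -> cores_dim C m B.
Proof.
move=> h_bij CA; case: CA h h_bij => {m A} [m A CA|m A E K f g fg CE CK] h h_bij.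
  have [h' [hK h'K]] := linear_inverse h_bij.
  have h'_bij : bijective h' by exists h.
  by apply: CoresDim0; apply: class_iso h'_bij CA.
have [f_inj fgE g_surj] := fg; have [h' hK h'K] := h_bij.
apply: (@CoresDimS _ _ m B E K (f \o h) g) => //; split=> // [x y /f_inj|x].
  exact: (can_inj hK).
rewrite fgE; split=> [[a <-]|[b <-]]; last by exists (h b).
by exists (h' a); rewrite /= h'K.
Qed.

(** The stretch of the long exact sequence in the second variable from
    Ext^(i+1)(A, B) to Ext^(i+2)(A, K). By dimension shifting only i = 0 is to be
    done: lift a map from a syzygy of A to B, then extend it to the cover. *)
Lemma Ext_zero_right i A (K B E : lmodType R) (f : {linear K -> B})
    (g : {linear B -> E}) :
  short_exact f g -> Ext_zero i.+1 A B -> Ext_zero i.+2 A K -> Ext_zero i.+1 A E.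
Proof.
move=> fg; elim: i A => [|i IHi] A.
  move=> /Ext_zero1P extB /Ext_zero_shift extK; apply/Ext_zero1P.
  apply: (ext1_of_presentation (cover_short_exact A)) => [|u].
    exact: free_projective.
  have /Ext_zero1P extK1 := extK _ _ _ _ (cover_short_exact A) (@free_projective _ _).
  have [v gv] := ext1_lift u extK1 fg.
  have [w wE] := extB _ _ _ _ (cover_short_exact A) v.
  by exists (g \o w) => k; rewrite /= wE gv.
move=> extB extK; apply/Ext_zero_shift => L P f' g' fg' P_proj.
apply: IHi; first by move/Ext_zero_shift: extB => /(_ _ _ _ _ fg' P_proj).
by move/Ext_zero_shift: extK => /(_ _ _ _ _ fg' P_proj).
Qed.

(** Each step of a D-resolution of B costs one degree of Ext. *)
Lemma Ext_zero_res_dim (D : lmodType R -> Prop) n A :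
  (forall i B, (1 <= i <= n)%N -> D B -> Ext_zero i A B) ->
  forall m B i, res_dim D m B -> (i + m < n)%N -> Ext_zero i.+1 A B.
Proof.
move=> extD m B i DB; elim: DB i => {m B} [m B DB|m B E K f g fg DE _ IH] i lt_n.
  by apply: extD DB; rewrite /= (leq_trans _ lt_n) // ltnS leq_addr.
apply: (Ext_zero_right fg); last by apply: IH; rewrite addSnnS.
by apply: extD DE; rewrite /= (leq_trans _ lt_n) // ltnS leq_addr.
Qed.

Lemma ext1_res_dim (D : lmodType R -> Prop) n A m B :
  (forall i B, (1 <= i <= n)%N -> D B -> Ext_zero i A B) ->
  res_dim D m B -> (m < n)%N -> ext1 A B.
Proof. by move=> extD DB m_lt; apply/Ext_zero1P/(Ext_zero_res_dim extD DB). Qed.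

(** Syzygies of modules in C stay in C, so higher Ext is Ext^1 of a module in
    C. *)
Lemma Ext_zero_hereditary (C : lmodType R -> Prop) B :
  closed_ker_epi C -> (forall P, projective P -> C P) ->
  (forall A, C A -> ext1 A B) -> forall i A, C A -> Ext_zero i.+1 A B.
Proof.
move=> C_ker C_proj ext_C; elim=> [|i IHi] A CA; first exact/Ext_zero1P/ext_C.
apply/Ext_zero_shift => K P f g fg P_proj.
by apply/IHi/(C_ker _ _ _ _ _ fg) => //; apply: C_proj.
Qed.

End ClassTools.

(** * Modules over the trivial extension *)

Section TrivextModules.
Variables (R : pzRingType) (M : bimod R).
Local Notation S := (trivext M).

(** What is needed of M to turn an R-module Y into a module over the trivial
    extension: an R-balanced action of square zero. *)
Record teact (Y : lmodType R) := Teact {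
  act :> M -> Y -> Y;
  actDl : forall m m' y, act (m + m') y = act m y + act m' y;
  actDr : forall m y y', act m (y + y') = act m y + act m y';
  actZ : forall r m y, act (r *: m) y = r *: act m y;
  act_bal : forall m r y, act (rscale m r) y = act m (r *: y);
  act_act : forall m m' y, act m (act m' y) = 0
}.

Definition te_mod_on (Y : lmodType R) (a : teact Y) : Type := Y.

Section TeMod.
Variables (Y : lmodType R) (a : teact Y).

Local Notation te_mod := (te_mod_on a).

HB.instance Definition _ := GRing.Zmodule.on te_mod.

Lemma act0l y : a 0 y = 0.
Proof. by rewrite -(scale0r (0 : M)) actZ scale0r. Qed.

Definition te_scale (c : S) (y : te_mod) : te_mod := c.1 *: (y : Y) + a c.2 y.

Fact te_scaleA c d y : te_scale c (te_scale d y) = te_scale (c * d) y.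
Proof.
case: c d => [r m] [s k]; rewrite /te_scale /= scalerDr !actDr !actDl act_act addr0.
by rewrite actZ act_bal scalerA addrA.
Qed.
Fact te_scale1 : left_id 1 te_scale.
Proof. by move=> y; rewrite /te_scale /= act0l addr0 scale1r. Qed.
Fact te_scaleDr : right_distributive te_scale +%R.
Proof. by move=> c x y; rewrite /te_scale scalerDr actDr addrACA. Qed.
Fact te_scaleDl y : {morph te_scale^~ y : c d / c + d}.
Proof. by move=> c d; rewrite /te_scale /= scalerDl actDl addrACA. Qed.
HB.instance Definition _ := GRing.Zmodule_isLmodule.Build S te_mod
  te_scaleA te_scale1 te_scaleDr te_scaleDl.

Lemma mact_te m (y : restr te_mod) : mact m y = a m y.
Proof. by rewrite -[LHS]/(te_scale (te_r m) y) /te_scale /= scale0r add0r. Qed.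

Lemma restr_te_scale r (y : restr te_mod) : r *: y = r *: (y : Y).
Proof. by rewrite -[LHS]/(te_scale (te_l M r) y) /te_scale /= act0l addr0. Qed.

Fact of_restr_linear : linear (fun y : restr te_mod => y : Y).
Proof. by move=> r x y; rewrite restr_te_scale. Qed.
Definition of_restr : {linear restr te_mod -> Y} := mklin of_restr_linear.

Fact to_restr_linear : linear (fun y : Y => y : restr te_mod).
Proof. by move=> r x y; rewrite restr_te_scale. Qed.
Definition to_restr : {linear Y -> restr te_mod} := mklin to_restr_linear.

End TeMod.

Lemma te_scaleE (X : lmodType S) (c : S) (x : X) :
  c *: x = (c.1 *: (x : restr X) + mact c.2 (x : restr X) : restr X).
Proof.
transitivity ((te_l M c.1 + te_r c.2) *: x); last exact: (@scalerDl _ X).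
by congr (_ *: _); case: c => r m; congr (_, _); rewrite /= ?addr0 ?add0r.
Qed.

Lemma te_linear (X Y : lmodType S) (f : {linear restr X -> restr Y}) :
  (forall m x, f (mact m x) = mact m (f x)) ->
  exists g : {linear X -> Y}, forall x, g x = f x.
Proof.
move=> fm; have f_lin : linear (f : X -> Y).
  by move=> c x y; rewrite !te_scaleE -fm -linearZ /= -!raddfD.
by exists (mklin f_lin).
Qed.

Section Triv.
Variable A : lmodType R.

Definition triv_act : teact A.
Proof. by exists (fun _ _ => 0) => *; rewrite ?addr0 ?scaler0. Defined.

Definition triv : lmodType S := te_mod_on triv_act.
End Triv.

Section Coind.
Variable A : lmodType R.

Definition coind_act : teact (A * lhom M A)%type.
Proof.
exists (fun (m : M) (y : A * lhom M A) => (y.2 m, 0)) =>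
  [m m' y|m y y'|r m y|m r y|m m' y] //;
  apply: injective_projections; rewrite /= ?addr0 ?scaler0 ?linearZ //.
exact: raddfD.
Defined.

Definition coind : lmodType S := te_mod_on coind_act.

Lemma mact_coind m (y : restr coind) : mact m y = (y.2 m, 0) :> A * lhom M A.
Proof. exact: mact_te. Qed.

Fact coind_fst_linear : linear (fun y : restr coind => y.1 : A).
Proof. by move=> r x y; rewrite restr_te_scale. Qed.
Definition coind_fst : {linear restr coind -> A} := mklin coind_fst_linear.

Fact coind_snd_linear : linear (fun y : restr coind => y.2 : lhom M A).
Proof. by move=> r x y; rewrite restr_te_scale. Qed.
Definition coind_snd : {linear restr coind -> lhom M A} := mklin coind_snd_linear.

Definition coind_inl : {linear A -> restr coind} :=
  to_restr coind_act \o inl_lin A (lhom M A).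
Definition coind_inr : {linear lhom M A -> restr coind} :=
  to_restr coind_act \o inr_lin A (lhom M A).

Variables (X : lmodType S) (u : {linear restr X -> A}).

(** The adjunction between [restr] and [coind]. *)
Lemma coind_lift : exists v : {linear X -> coind},
  forall x, v x = (u x, hom_map M u (beta X x)).
Proof.
have f_lin : linear (fun x : restr X =>
    to_restr coind_act (u x, hom_map M u (beta X x))).
  by move=> r x y; rewrite -linearP; congr (to_restr _ _); rewrite !linearP.
have [m x|v vE] := @te_linear X coind (mklin f_lin); last by exists v.
rewrite [RHS]mact_coind /=; congr (_, _); apply: homP => m' /=.
by rewrite mact_mact raddf0.
Qed.

End Coind.

Lemma coind_map (A B : lmodType R) (f : {linear A -> B}) :
  exists v : {linear coind A -> coind B},
    forall y : A * lhom M A, v y = (f y.1, hom_map M f y.2).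
Proof.
have [v vE] := coind_lift (f \o coind_fst A).
exists v => y; rewrite vE; congr (_, _); apply: homP => m /=.
by rewrite scale0r add0r.
Qed.

Section Ind.
Variable A : lmodType R.

Definition ind_act : teact (A * tens M A)%type.
Proof.
exists (fun (m : M) (y : A * tens M A) => (0, tensor m y.1)) =>
  [m m' y|m y y'|r m y|m r y|m m' y];
  apply: injective_projections; rewrite /= ?addr0 ?scaler0 ?tensorZ ?tensor_bal //.
- exact: tensorDl.
- exact: tensorDr.
- by apply: (addrI (tensor m 0)); rewrite -tensorDr !addr0.
Defined.

Definition ind : lmodType S := te_mod_on ind_act.

Lemma mact_ind m (y : restr ind) : mact m y = (0, tensor m y.1) :> A * tens M A.
Proof. exact: mact_te. Qed.

Definition ind_inl : {linear A -> restr ind} := to_restr ind_act \o inl_lin A (tens M A).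
Definition ind_inr : {linear tens M A -> restr ind} :=
  to_restr ind_act \o inr_lin A (tens M A).

Fact ind_fst_linear : linear (fun y : restr ind => y.1 : A).
Proof. by move=> r x y; rewrite restr_te_scale. Qed.
Definition ind_fst : {linear restr ind -> A} := mklin ind_fst_linear.

Fact ind_snd_linear : linear (fun y : restr ind => y.2 : tens M A).
Proof. by move=> r x y; rewrite restr_te_scale. Qed.
Definition ind_snd : {linear restr ind -> tens M A} := mklin ind_snd_linear.

Variables (X : lmodType S) (u : {linear A -> restr X}).

Lemma mact_alpha m t : mact m (alpha X t) = 0.
Proof.
have ba0 : beta X (alpha X t) = 0.
  apply: (@tens_ext _ _ _ _ (beta X \o alpha X) (null_lin _ _)) => k x.
  by apply: homP => m'; rewrite /= alphaE mact_mact.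
by rewrite -betaE ba0.
Qed.

(** The adjunction between [ind] and [restr]; [ind_linear_eq] is its uniqueness
    part. *)
Lemma ind_lift : exists v : {linear ind -> X},
  forall y : A * tens M A, v y = u y.1 + alpha X (tens_map M u y.2).
Proof.
have [m x|v vE] := @te_linear ind X
    ((u \o ind_fst) \+ (alpha X \o (tens_map M u \o ind_snd))); last first.
  by exists v.
by rewrite mact_ind /= mactDr mact_alpha addr0 raddf0 add0r tens_mapE alphaE.
Qed.

Lemma ind_linear_eq (v w : {linear ind -> X}) :
  (forall a, restr_map v (ind_inl a) = restr_map w (ind_inl a)) -> v =1 w.
Proof.
move=> vw y.
have yE : y = ind_inl y.1 + ind_inr y.2 :> restr ind.
  by rewrite [y]surjective_pairing; congr (_, _); rewrite /= ?addr0 ?add0r.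
rewrite yE -[v _]/(restr_map v _) -[w _]/(restr_map w _) !raddfD /= vw; congr (_ + _).
apply: (@tens_ext _ _ _ _ (restr_map v \o ind_inr) (restr_map w \o ind_inr)) => m x.
have mx : ind_inr (tensor m x) = mact m (ind_inl x) by rewrite mact_ind.
rewrite -[LHS]/(restr_map v (ind_inr _)) -[RHS]/(restr_map w (ind_inr _)) mx.
by rewrite !restr_map_mact vw.
Qed.

Lemma alpha_ind_inl t : alpha ind (tens_map M ind_inl t) = ind_inr t.
Proof.
apply: (@tens_ext _ _ _ _ (alpha ind \o tens_map M ind_inl) ind_inr) => m x /=.
by rewrite tens_mapE alphaE mact_ind.
Qed.

End Ind.

Lemma ind_map (A B : lmodType R) (f : {linear A -> B}) :
  exists v : {linear ind A -> ind B},
    forall y : A * tens M A, v y = (f y.1, tens_map M f y.2).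
Proof.
have [v vE] := ind_lift (ind_inl B \o f).
exists v => y; rewrite vE -tens_map_comp alpha_ind_inl.
by apply: injective_projections; rewrite /= ?addr0 ?add0r.
Qed.

End TrivextModules.

Section TrivextClosure.
Variables (R : pzRingType) (M : bimod R) (C : modclass R).

(** A sequence of R-modules is a sequence of S-modules on which M acts by
    zero. *)
Lemma frakU_extensions : closed_extensions (frakU M C) -> closed_extensions C.
Proof.
move=> U_ext A B E f g fg CA CB.
pose out (X : lmodType R) := of_restr (triv_act M X).
pose into (X : lmodType R) := to_restr (triv_act M X).
have out_bij X : bijective (out X) by exists id.
have into_bij X : bijective (into X) by exists id.
have triv_map (X Y : lmodType R) (h : {linear X -> Y}) :
    exists h' : {linear triv M X -> triv M Y}, forall x : X, h' x = h x.
  have [m x|h' h'E] := @te_linear _ M (triv M X) (triv M Y) (into Y \o (h \o out X)).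
    by rewrite !mact_te raddf0.
  by exists h'.
have [f' f'E] := triv_map _ _ f; have [g' g'E] := triv_map _ _ g.
have [f_inj fgE g_surj] := fg.
apply: class_iso (out_bij E) _; apply: (U_ext _ _ _ f' g'); last 2 first.
- exact: class_iso (into_bij A) CA.
- exact: class_iso (into_bij B) CB.
split=> [x y|e|b]; first by rewrite !f'E => /f_inj.
  by rewrite g'E fgE; split=> -[a <-]; exists a; rewrite f'E.
by have [e <-] := g_surj b; exists e; rewrite g'E.
Qed.

Lemma frakU_summands : closed_summands C -> closed_summands (frakU M C).
Proof.
move=> C_summ A B CAB; apply: (C_summ (restr A) (restr B)).
have h_lin : linear (fun x : restr (A * B)%type => x : (restr A * restr B)%type) by [].
have h_bij : bijective (mklin h_lin) by exists id.
exact: class_iso h_bij CAB.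
Qed.

End TrivextClosure.

(** * Coinduced modules *)

Section HomExact.
Variables (R : pzRingType) (M : bimod R).
Implicit Types A B C : lmodType R.

Definition to_lhom A (v : {linear M -> A}) : lhom M A := Hom (linearP v).

(** Surjectivity on the right is the lifting of maps out of M. *)
Lemma hom_short_exact A B C (f : {linear A -> B}) (g : {linear B -> C}) :
  ext1 M A -> short_exact f g -> short_exact (hom_map M f) (hom_map M g).
Proof.
move=> extM fg; have [f_inj fgE g_surj] := fg; split=> [h k hk|h|h].
- apply: homP => m; apply: f_inj.
  exact: (congr1 (fun h : lhom M B => h m) hk).
- split=> [gh|[k <-]]; last by apply: homP => m; apply: (short_exact_comp0 _ fg).
  have [k fk] : exists k : {linear M -> A}, forall m, f (k m) = h m.
    apply: factor_inj => // m; apply/fgE.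
    exact: (congr1 (fun h : lhom M C => h m) gh).
  by exists (to_lhom k); apply: homP.
- have [v gv] := ext1_lift (h : {linear M -> C}) extM fg.
  by exists (to_lhom v); apply: homP.
Qed.

End HomExact.

Section Coinduced.
Variables (R : pzRingType) (M : bimod R).
Local Notation S := (trivext M).
Implicit Types (A B F G : lmodType R) (X Y : lmodType S).

(** Over R, Y is an extension of Hom(M, F) by F, and m in M acts on Y by
    evaluating the image in Hom(M, F) at m. The module [coind F] is the split
    case; in general F is the kernel of the structure map. *)
Definition coind_ext F Y : Prop :=
  exists (j : {linear F -> restr Y}) (q : {linear restr Y -> lhom M F}),
    short_exact j q /\ forall m y, mact m y = j (q y m).

(** The structure map Y -> Hom(M, Y) factors as Y -> Hom(M, F) -> Hom(M, Y), a
    surjection followed by an injection. *)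
Lemma coind_ext_beta F Y : coind_ext F Y ->
  exact (beta Y) (hom_map M (beta Y)) /\
  exists h : {linear F -> ker (beta Y)}, bijective h.
Proof.
move=> [j [q [[j_inj jqE q_surj] mactE]]].
have beta0 y : beta Y y = 0 <-> q y = 0.
  split=> y0; apply: homP => m; last by rewrite betaE mactE y0 /= raddf0.
  by apply: j_inj; rewrite -mactE -betaE y0 raddf0.
split=> [h|].
  split=> [bh|[y <-]]; last by apply: homP => m; apply: homP => m'; apply: mact_mact.
  have [k jk] : exists k : {linear M -> F}, forall m, j (k m) = h m.
    apply: factor_inj => // m; apply/jqE/beta0.
    exact: (congr1 (fun h : lhom M (lhom M (restr Y)) => h m) bh).
  have [y qy] := q_surj (to_lhom k).
  by exists y; apply: homP => m; rewrite betaE mactE qy /= jk.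
have jP a : beta Y (j a) = 0 by apply/beta0/jqE; exists a.
have h_lin : linear (fun a => to_ker (jP a)).
  by move=> r x y; apply: val_inj; rewrite /= linearP.
have /choice[p pK] : forall k : ker (beta Y), exists a, j a = \val k.
  by move=> k; apply/jqE/beta0/kerP.
exists (mklin h_lin), p => [a|k]; first by apply: j_inj; rewrite pK.
by apply: val_inj; rewrite /= pK.
Qed.

(** By exactness the image of the structure map is the kernel of
    Hom(M, beta), which is Hom(M, ker beta). *)
Lemma coind_ext_ker Y :
  exact (beta Y) (hom_map M (beta Y)) -> coind_ext (ker (beta Y)) Y.
Proof.
move=> bE.
have mP m y : beta Y (mact m y) = 0 by apply: homP => m'; rewrite betaE mact_mact.
have q0_lin y : linear (fun m => to_ker (mP m y)).
  by move=> r m m'; apply: val_inj; rewrite /= mactDl mactZ.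
have q_lin : linear (fun y => Hom (q0_lin y)).
  move=> r x y; apply: homP => m; apply: val_inj.
  by rewrite /= mactDr -mact_bal.
exists (\val : ker (beta Y) -> restr Y), (mklin q_lin); split=> //; split=> [|y|h].
- exact: val_inj.
- split=> [qy|[k <-]].
    suff by0 : beta Y y = 0 by exists (to_ker by0).
    apply: homP => m.
    by have /(congr1 (fun h : lhom M (ker (beta Y)) => \val (h m))) := qy.
  apply: homP => m; apply: val_inj => /=.
  by rewrite -betaE kerP.
- have /bE[y yE] : hom_map M (beta Y) (hom_map M (\val : ker (beta Y) -> restr Y) h) = 0.
    by apply: homP => m; rewrite /= (kerP (h m)).
  exists y; apply: homP => m; apply: val_inj.
  exact: (congr1 (fun h : lhom M (restr Y) => h m) yE).
Qed.

Lemma frakJP (D : modclass R) Y : frakJ M D Y <-> exists F, D F /\ coind_ext F Y.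
Proof.
split=> [[DK /coind_ext_ker FY]|[F [DF FY]]]; first by exists (ker (beta Y)).
have [bE [h h_bij]] := coind_ext_beta FY.
by split=> //; apply: class_iso h_bij DF.
Qed.

Lemma coind_ext_coind F : coind_ext F (coind M F).
Proof.
exists (coind_inl M F), (coind_snd M F); split=> [|m y]; last by rewrite mact_coind.
split=> [x y []|y|h] //; last by exists (0, h).
split=> [y0|[a <-]//]; exists y.1.
by apply: injective_projections => //=; rewrite -y0.
Qed.

Lemma coind_ext_unique F G Y : coind_ext F Y -> coind_ext G Y ->
  exists h : {linear F -> G}, bijective h.
Proof.
move=> /coind_ext_beta[_ [h h_bij]] /coind_ext_beta[_ [k k_bij]].
have [k' [kK k'K]] := linear_inverse k_bij.
exists (k' \o h); apply: bij_comp h_bij; by exists k.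
Qed.

(** A map between such modules preserves the filtrations, so it is given by
    f' : F -> B on the kernels and by Hom(M, f') on the quotients. If it is
    injective with cokernel Y, then Y is filtered by coker f' and by the cokernel
    of Hom(M, f'), which is Hom(M, coker f') because Ext^1(M, F) = 0. *)
Lemma coind_ext_quotient F B (Y1 Y0 Y : lmodType S)
    (f : {linear Y1 -> Y0}) (g : {linear Y0 -> Y}) :
  short_exact f g -> ext1 M F -> coind_ext F Y1 -> coind_ext B Y0 ->
  exists G (f' : {linear F -> B}) (g' : {linear B -> G}),
    short_exact f' g' /\ coind_ext G Y.
Proof.
move=> fg extM [j1 [q1 [[j1_inj jq1 q1_surj] mact1]]].
move=> [j0 [q0 [[j0_inj jq0 q0_surj] mact0]]].
have [f_inj fgE g_surj] := fg.
have q1j1 a : q1 (j1 a) = 0 by apply/jq1; exists a.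
have q0j0 a : q0 (j0 a) = 0 by apply/jq0; exists a.
have gf y : g (f y) = 0 by apply/fgE; exists y.
have [f' f'E] : exists f' : {linear F -> B}, forall a, j0 (f' a) = restr_map f (j1 a).
  apply: (factor_inj (h := restr_map f \o j1)) => // a; apply/jq0; apply: homP => m.
  apply: j0_inj; by rewrite -mact0 /= -restr_map_mact mact1 q1j1 /= !raddf0.
have q0f y m : q0 (restr_map f y) m = f' (q1 y m).
  by apply: j0_inj; rewrite -mact0 -restr_map_mact mact1 f'E.
have f'_inj : injective f'.
  apply: raddf_inj => a /= f'a; apply: j1_inj; apply: f_inj.
  by rewrite -[LHS]f'E f'a !raddf0 /=.
pose c := coker_proj f'.
have f'c : short_exact f' c := coker_short_exact f'_inj.
exists (coker f'), f', c; split=> //.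
have [_ f'cE c_surj] := f'c; have [hom_inj homE hom_surj] := hom_short_exact extM f'c.
have [j jE] : exists j : {linear coker f' -> restr Y},
    forall b, j (c b) = (restr_map g \o j0) b.
  by apply: factor_surj => // b /f'cE[a <-]; rewrite /= f'E; apply: gf.
have [q qE] : exists q : {linear restr Y -> lhom M (coker f')},
    forall y, q (restr_map g y) = (hom_map M c \o q0) y.
  apply: factor_surj => [|y gy]; first exact: g_surj.
  have [y1 <-] := (fgE y).1 gy.
  by apply: homP => m; rewrite /= [q0 _ _]q0f; apply/f'cE; exists (q1 y1 m).
have mactE m y : mact m y = j (q y m).
  have [y0 <-] := g_surj y; rewrite -[g y0]/(restr_map g y0) qE /= jE /=.
  by rewrite -restr_map_mact mact0.
exists j, q; split=> //; split=> [|y|h].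
- apply: raddf_inj => x /=; have [b <-] := c_surj x; rewrite jE /= => gj0b.
  have [y1 fy1] := (fgE (j0 b)).1 gj0b.
  have /jq1[a ay1] : q1 y1 = 0.
    apply: homP => m; apply: f'_inj; rewrite -q0f.
    by rewrite -[restr_map f y1]/(f y1) fy1 q0j0 /= raddf0.
  apply/f'cE; exists a; apply: j0_inj.
  by rewrite f'E ay1.
- split=> [qy|[x <-]]; last first.
    have [b <-] := c_surj x; rewrite jE /= qE /= q0j0; exact: raddf0.
  have [y0 gy0] := g_surj y.
  have /homE[h hE] : hom_map M c (q0 y0) = 0.
    by rewrite -[LHS]qE -[restr_map g y0]/(g y0) gy0.
  have [y1 q1y1] := q1_surj h.
  have /jq0[b bE] : q0 (y0 - restr_map f y1) = 0.
    apply/eqP; rewrite raddfB subr_eq0 /= -hE; apply/eqP; apply: homP => m.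
    by rewrite /= q0f q1y1.
  have gE : g (y0 - f y1) = y by rewrite raddfB /= gf gy0 subr0.
  by exists (c b); rewrite jE -[RHS]gE /= bE.
- have [k kh] := hom_surj h; have [y0 q0y0] := q0_surj k.
  by exists (restr_map g y0); rewrite qE /= q0y0.
Qed.

(** Taking kernels of structure maps turns a J^D-resolution into a
    D-resolution. *)
Lemma coind_ext_res_dim (D : modclass R) n :
  (forall m F, res_dim D m F -> (m < n)%N -> ext1 M F) ->
  forall m Y, res_dim (frakJ M D) m Y -> (m <= n)%N ->
  exists F, res_dim D m F /\ coind_ext F Y.
Proof.
move=> extM m Y DY; elim: DY => {m Y} [m Y /frakJP[F [DF FY]] _|].
  by exists F; split=> //; apply: ResDim0.
move=> m Y Y0 Y1 f g fg /frakJP[B [DB BY0]] _ IH lt_mn.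
have [F [DF FY1]] := IH (ltnW lt_mn).
have [G [f' [g' [fg' GY]]]] := coind_ext_quotient fg (extM _ _ DF lt_mn) FY1 BY0.
by exists G; split=> //; apply: ResDimS fg' DB DF.
Qed.

(** An R-linear retraction Y -> F corresponds by adjunction to an S-linear map
    Y -> [coind F], which is the identity on F and on Hom(M, F). *)
Lemma coind_ext_iso F Y : coind_ext F Y -> ext1 (lhom M F) F ->
  exists v : {linear Y -> coind M F}, bijective v.
Proof.
move=> [j [q [jq mactE]]] extF; have [p pj] := ext1_retraction extF jq.
have [j_inj jqE q_surj] := jq.
have [v vE] := coind_lift p; exists v.
have vE' y : v y = (p y, q y).
  rewrite vE; congr (_, _); apply: homP => m.
  by rewrite /= mactE pj.
have v_inj : injective v.
  apply: raddf_inj => y /=; rewrite vE' => -[py /jqE[a ay]].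
  by rewrite -ay -(pj a) ay py; apply: raddf0.
have /choice[w wK] : forall z, exists y, v y = z.
  move=> [a h]; have [y qy] := q_surj h.
  exists (y + j (a - p y) : restr Y); rewrite vE'; congr (_, _).
    by rewrite raddfD /= pj addrC subrK.
  by rewrite raddfD /= (short_exact_comp0 _ jq) addr0.
by exists w => // y; apply: v_inj; rewrite wK.
Qed.

Lemma coind_short_exact A B F (f : {linear A -> B}) (g : {linear B -> F}) :
  ext1 M A -> short_exact f g ->
  exists (f' : {linear coind M A -> coind M B}) (g' : {linear coind M B -> coind M F}),
    [/\ short_exact f' g',
        forall y : A * lhom M A, f' y = (f y.1, hom_map M f y.2)
      & forall y : B * lhom M B, g' y = (g y.1, hom_map M g y.2)].
Proof.
move=> extM fg; have [f_inj fgE g_surj] := fg.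
have [hf_inj hfgE hg_surj] := hom_short_exact extM fg.
have [f' f'E] := coind_map M f; have [g' g'E] := coind_map M g.
exists f', g'; split=> //; split=> [x y|[b h]|[c h]].
- rewrite !f'E => -[/f_inj e1 e2]; apply: injective_projections => //.
  by apply: hf_inj; apply: homP => m; apply: (congr1 (fun h : M -> B => h m) e2).
- rewrite g'E /=; split=> [[/fgE[a fa] h0]|[[a k]]].
    have /hfgE[k hk] : hom_map M g h = 0.
      by apply: homP => m; apply: (congr1 (fun h : M -> F => h m) h0).
    by exists (a, k); rewrite f'E /= fa hk.
  rewrite f'E /= => -[<- <-]; apply: injective_projections => /=.
    exact: short_exact_comp0 fg.
  by apply/hfgE; exists k.
- have [b gb] := g_surj c; have [k gk] := hg_surj h.
  by exists (b, k); rewrite g'E /= gb gk.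
Qed.

Lemma coind_res_dim (D : modclass R) n :
  (forall m F, res_dim D m F -> (m < n)%N -> ext1 M F) ->
  forall m F, res_dim D m F -> (m <= n)%N -> res_dim (frakJ M D) m (coind M F).
Proof.
move=> extM m F DF; elim: DF => {m F} [m F DF|m F B K f g fg DB DK IH] lt_mn.
  by apply: ResDim0; apply/frakJP; exists F; split=> //; apply: coind_ext_coind.
have [f' [g' [fg' _ _]]] := coind_short_exact (extM _ _ DK lt_mn) fg.
apply: ResDimS fg' _ (IH (ltnW lt_mn)).
by apply/frakJP; exists B; split=> //; apply: coind_ext_coind.
Qed.

(** By adjunction, extending an S-linear map into [coind F] amounts to extending
    an R-linear map into F. *)
Lemma ext1_coind X F : ext1 (restr X) F -> ext1 X (coind M F).
Proof.
move=> extX K P f g fg u.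
have [w wE] : exists w : {linear restr P -> F},
    forall k, w (restr_map f k) = (coind_fst M F \o restr_map u) k.
  exact: (extX _ _ (restr_map f) (restr_map g) fg).
have [v vE] := coind_lift w; exists v => k.
rewrite vE -[f k]/(restr_map f k) wE.
apply: injective_projections => //; apply: homP => m.
rewrite /= -restr_map_mact wE /= restr_map_mact mact_coind //.
Qed.

(** Restriction need not preserve projectives, but [coind] keeps an extension E
    of Q by F exact when Ext^1(M, F) = 0. The unit Q -> [coind Q] then lifts to
    [coind E], and composing with the projection to E splits the extension. *)
Lemma ext1_restr_projective (Q : lmodType S) F :
  ext1 M F -> projective Q -> ext1 (restr Q) F.
Proof.
move=> extM Q_proj; apply: ext1_of_sections => E f g fg.
have [f' [g' [[_ _ g'_surj] f'E g'E]]] := coind_short_exact extM fg.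
have [eta etaE] := coind_lift (idfun : {linear restr Q -> restr Q}).
have [s sE] := Q_proj _ _ g' eta g'_surj.
exists (coind_fst M E \o restr_map s) => x.
have := sE x; rewrite g'E etaE => -[-> _] //.
Qed.

End Coinduced.

(** * Left cotorsion pairs *)

Section LeftPair.
Variables (R : pzRingType) (M : bimod R) (n : nat) (C D : modclass R).
Hypotheses (n_ge1 : (1 <= n)%N) (pair : left_cotorsion_pair n C D).
Hypothesis extM : forall (i : nat) (B : lmodType R),
  (1 <= i <= n)%N -> D B -> Ext_zero i M B.
Hypothesis extHom :
  forall F : lmodType R, wedge D n.-1 F -> Ext_zero 1 (lhom M F) F.
Hypothesis U_res : resolving (frakU M C).
Hypothesis J_ext : closed_extensions (wedge (frakJ M D) n.-1).

Local Notation W := (res_dim D n.-1).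

Fact left_dim_ext1M m F : res_dim D m F -> (m < n)%N -> ext1 M F.
Proof. exact: ext1_res_dim. Qed.

(** The approximation of A splits, so A is a direct summand of a module in C.
    Hence membership in C can be tested by Ext^1 alone. *)
Fact left_class_of_ext1 A : (forall F, W F -> ext1 A F) -> C A.
Proof.
move=> extA; have [K [E [f [g [fg CE /wedgeP WK]]]]] := lcp_approx pair A.
have [s gs] := ext1_section (extA K WK) fg.
exact: closed_summands_retracts (lcp_summands pair) _ _ _ _ gs CE.
Qed.

Fact left_ext1 A B : C A -> D B -> ext1 A B.
Proof. by move=> CA DB; apply/Ext_zero1P; apply: lcp_Ext pair _ _ _ _ CA DB. Qed.

(** [coind (F * G)] is an extension of [coind G] by [coind F], hence of finite
    J^D-dimension, and its kernel of the structure map is [F * G]. *)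
Fact left_dim_prod F G : W F -> W G -> W (F * G)%type.
Proof.
move=> WF WG; have lt_n : (n.-1 < n)%N by rewrite ltn_predL.
have lr : short_exact (inl_lin F G) (snd : (F * G)%type -> G).
  split=> [x y []|[x y]|y] //; last by exists (0, y).
  by split=> [/= ->|[a <-]//]; exists x.
have [f' [g' [fg' _ _]]] := coind_short_exact (left_dim_ext1M WF lt_n) lr.
have J_wedge H : W H -> wedge (frakJ M D) n.-1 (coind M H).
  by move=> WH; apply/wedgeP; apply: coind_res_dim left_dim_ext1M _ _ WH (ltnW lt_n).
have /wedgeP JFG := J_ext fg' (J_wedge _ WF) (J_wedge _ WG).
have [H [WH HFG]] := coind_ext_res_dim left_dim_ext1M JFG (ltnW lt_n).
have [h h_bij] := coind_ext_unique HFG (coind_ext_coind M (F * G)%type).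
exact: res_dim_iso h_bij WH.
Qed.

(** By [left_class_of_ext1] it suffices that Ext^1(Hom(M, F), G) = 0 for G of
    finite D-dimension. This is a summand of Ext^1(Hom(M, F x G), F x G). *)
Fact left_class_hom F : W F -> C (lhom M F).
Proof.
move=> WF; apply: left_class_of_ext1 => G WG.
have /Ext_zero1P extFG := extHom ((wedgeP _ _ _).2 (left_dim_prod WF WG)).
pose i := hom_map M (inl_lin F G); pose p := hom_map M (fst : (F * G)%type -> F).
apply: (ext1_retract (i := i) (p := p) (i' := inr_lin F G) (p' := snd)) extFG => //.
by move=> h; apply: homP.
Qed.

Fact left_class_projective (Q : lmodType (trivext M)) : projective Q -> frakU M C Q.
Proof.
move=> Q_proj; apply: left_class_of_ext1 => F WF.
apply: ext1_restr_projective Q_proj.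
by apply: left_dim_ext1M WF _; rewrite ltn_predL.
Qed.

Fact left_pair_Ext i (X Y : lmodType (trivext M)) :
  frakU M C X -> frakJ M D Y -> Ext_zero i.+1 X Y.
Proof.
move=> CX /frakJP[F [DF FY]].
have /Ext_zero1P extF := extHom ((wedgeP _ _ _).2 (ResDim0 n.-1 DF)).
have [v /linear_inverse[w [vK wK]]] := coind_ext_iso FY extF.
apply: (Ext_zero_hereditary (C := frakU M C)) CX => //.
- by case: U_res.
- exact: left_class_projective.
move=> A CA; apply: (ext1_retract (i := idfun) (p := idfun) (i' := v) (p' := w)) => //.
exact/ext1_coind/left_ext1.
Qed.

(** The pullback E of [coind C0] along the unit X -> [coind X] has the kernel
    [coind K0] over X; as an R-module, it is an extension of C0 by Hom(M, K0). *)
Fact left_pair_approx (X : lmodType (trivext M)) :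
  exists (K E : lmodType (trivext M)) (f : {linear K -> E}) (g : {linear E -> X}),
    [/\ short_exact f g, frakU M C E & wedge (frakJ M D) n.-1 K].
Proof.
have [K0 [C0 [f [g [fg CC0 /wedgeP WK0]]]]] := lcp_approx pair (restr X).
have lt_n : (n.-1 < n)%N by rewrite ltn_predL.
have extMK0 := left_dim_ext1M WK0 lt_n.
have [f' [g' [fg' f'E g'E]]] := coind_short_exact extMK0 fg.
have [eta etaE] := coind_lift (idfun : {linear restr X -> restr X}).
have [E [i [p [v [ip vi gv]]]]] := pullback eta fg'.
exists (coind M K0), E, i, p; split=> //; last first.
  by apply/wedgeP; apply: coind_res_dim left_dim_ext1M _ _ WK0 (ltnW lt_n).
have [C_ext _] := U_res.
apply: (frakU_extensions C_ext (f := restr_map i \o coind_inr M K0)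
  (g := coind_fst M C0 \o restr_map v)) (left_class_hom WK0) CC0.
have [[f_inj fgE g_surj] [i_inj ipE p_surj]] := (fg, ip).
have [[_ _ hg_surj] [_ fg'E _]] := (hom_short_exact extMK0 fg, fg').
split=> [h k /= /i_inj[]//|e|c].
  split=> [/= ve1|[h <-]]; last by rewrite /= [restr_map v _]vi f'E /= raddf0.
  have pe0 : p e = 0.
    have := gv e; rewrite g'E etaE => -[<- _].
    by rewrite [(v e).1]ve1 raddf0.
  have [[a k] ie] := (ipE e).1 pe0.
  have a0 : a = 0.
    by apply: f_inj; rewrite raddf0 -ve1 -ie /= [restr_map v _]vi f'E.
  by exists k; rewrite -ie a0.
(* a point of E over c: a pair (c, h) in coind C0 lying over the image of g c in
   coind X, and g c itself *)
have [h hE] := hg_surj (beta X (g c)).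
have [e0 pe0] := p_surj (g c).
have /fg'E[a aE] : g' ((c, h) - v e0) = 0.
  rewrite raddfB /= gv pe0 etaE g'E -hE; apply/eqP; rewrite subr_eq0; apply/eqP.
  by apply: injective_projections => //; apply: homP.
exists (e0 + i a); rewrite /= [restr_map v _]raddfD /= vi aE.
by rewrite addrC subrK.
Qed.

Theorem trivext_left_pair : left_cotorsion_pair n (frakU M C) (frakJ M D).
Proof.
split.
- exact/frakU_summands/(lcp_summands pair).
- by move=> [|i] X Y // _; apply: left_pair_Ext.
- exact: left_pair_approx.
Qed.

End LeftPair.

(** * Induced modules *)

Section Induced.
Variables (R : pzRingType) (M : bimod R).
Local Notation S := (trivext M).
Implicit Types (A B E F : lmodType R) (X Y : lmodType S).

(** Over R, X is an extension of A by M (x) A, and m in M acts on X by sending x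
    to m (x) a, for a the image of x in A. The module [ind A] is the split case;
    in general A is the cokernel of the structure map. *)
Definition ind_ext A X : Prop :=
  exists (j : {linear tens M A -> restr X}) (q : {linear restr X -> A}),
    short_exact j q /\ forall m x, mact m x = j (tensor m (q x)).

Lemma alpha_ind_ext A X (j : {linear tens M A -> restr X}) (q : {linear restr X -> A}) :
  (forall m x, mact m x = j (tensor m (q x))) ->
  forall t, alpha X t = j (tens_map M q t).
Proof.
move=> mactE; apply: (@tens_ext _ _ _ _ (alpha X) (j \o tens_map M q)) => m x.
by rewrite [LHS]alphaE mactE /= tens_mapE.
Qed.

(** The structure map M (x) X -> X factors as M (x) X -> M (x) A -> X, a
    surjection followed by an injection; the kernel of the first factor is the
    image of M (x) (M (x) A), by right exactness. *)
Lemma ind_ext_alpha A X : ind_ext A X ->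
  exact (tens_map M (alpha X)) (alpha X) /\
  exists h : {linear coker (alpha X) -> A}, bijective h.
Proof.
move=> [j [q [jq /alpha_ind_ext aE]]]; have [j_inj jqE q_surj] := jq.
have tq_surj := tens_map_surj (M := M) q_surj.
have im_alpha x : q x = 0 <-> exists t, alpha X t = x.
  rewrite jqE; split=> [[s <-]|[t <-]]; last by exists (tens_map M q t).
  by have [t <-] := tq_surj s; exists t.
split=> [t|].
  have -> : alpha X t = 0 <-> tens_map M q t = 0.
    by rewrite aE; split=> [|->]; [rewrite -[X in _ = X](raddf0 j) => /j_inj | rewrite raddf0].
  rewrite (tens_right_exact jqE q_surj t); split=> [[s <-]|[s <-]].
    have [r <-] := tens_map_surj (M := M) tq_surj s; exists r.
    by rewrite /= tens_map_comp; apply: eq_tens_map.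
  exists (tens_map M (tens_map M q) s).
  by rewrite /= tens_map_comp; apply: eq_tens_map => x; rewrite aE.
have [h hE] : exists h : {linear coker (alpha X) -> A},
    forall x, h (coker_proj (alpha X) x) = q x.
  apply: factor_surj => [|x /coker_proj_eq0/im_alpha//].
  exact: coker_proj_surj.
have h_inj : injective h.
  apply: raddf_inj => c; have [x <-] := @coker_proj_surj _ _ _ (alpha X) c.
  by rewrite /= hE => /im_alpha/coker_proj_eq0.
have /choice[s sK] : forall a, exists c, h c = a.
  by move=> a; have [x <-] := q_surj a; exists (coker_proj (alpha X) x).
by exists h, s => // c; apply: h_inj.
Qed.

(** By right exactness M (x) coker alpha is the quotient of M (x) X by the image
    of M (x) alpha, which exactness identifies with the kernel of alpha. *)
Lemma ind_ext_coker X :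
  exact (tens_map M (alpha X)) (alpha X) -> ind_ext (coker (alpha X)) X.
Proof.
move=> aE; pose q := coker_proj (alpha X).
have aqE : exact (alpha X) q by move=> x; apply: coker_proj_eq0.
have q_surj : surjective q := @coker_proj_surj _ _ _ (alpha X).
have tq_surj := tens_map_surj (M := M) q_surj.
have tqE t : tens_map M q t = 0 <-> alpha X t = 0.
  by rewrite (tens_right_exact aqE q_surj t) (aE t).
have [j jE] : exists j : {linear tens M (coker (alpha X)) -> restr X},
    forall t, j (tens_map M q t) = alpha X t.
  by apply: factor_surj => // t /tqE.
exists j, q; split=> [|m x]; last by rewrite -alphaE -jE /= tens_mapE.
split=> [|x|//].
  apply: raddf_inj => s; have [t <-] := tq_surj s.
  by rewrite /= jE => /tqE.
rewrite (aqE x); split=> [[t <-]|[s <-]]; first by exists (tens_map M q t).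
by have [t <-] := tq_surj s; exists t.
Qed.

Lemma frakBP (C : modclass R) X : frakB M C X <-> exists A, C A /\ ind_ext A X.
Proof.
split=> [[CK /ind_ext_coker KX]|[A [CA AX]]]; first by exists (coker (alpha X)).
have [aE [h /linear_inverse[k [hK kK]]]] := ind_ext_alpha AX.
have k_bij : bijective k by exists h.
by split=> //; apply: class_iso k_bij CA.
Qed.

Lemma ind_ext_ind A : ind_ext A (ind M A).
Proof.
exists (ind_inr M A), (ind_fst M A); split=> [|m x]; last by rewrite mact_ind.
split=> [x y []|y|a] //; last by exists (a, 0).
split=> [y0|[t <-]//]; exists y.2.
by apply: injective_projections => //=; rewrite -y0.
Qed.

Lemma ind_ext_unique A B X : ind_ext A X -> ind_ext B X ->
  exists h : {linear A -> B}, bijective h.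
Proof.
move=> /ind_ext_alpha[_ [h h_bij]] /ind_ext_alpha[_ [k k_bij]].
have [h' [hK h'K]] := linear_inverse h_bij.
by exists (k \o h'); apply: bij_comp k_bij _; exists h.
Qed.

(** The dual of [coind_ext_quotient]: an epimorphism between
    such modules is given by g' : A0 -> A1 on the cokernels of the structure maps
    and by M (x) g' on the submodules, and M (x) ker g' is the kernel of the
    latter because Tor_1(M, A1) = 0. *)
Lemma ind_ext_sub A0 A1 (X X0 X1 : lmodType S) (f : {linear X -> X0})
    (g : {linear X0 -> X1}) :
  short_exact f g -> tor1 M A1 -> ind_ext A0 X0 -> ind_ext A1 X1 ->
  exists A (i : {linear A -> A0}) (g' : {linear A0 -> A1}),
    short_exact i g' /\ ind_ext A X.
Proof.
move=> fg torA1 [j0 [q0 [jq0 mact0]]] [j1 [q1 [jq1 mact1]]].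
have [f_inj fgE g_surj] := fg.
have [j0_inj jq0E q0_surj] := jq0; have [j1_inj jq1E q1_surj] := jq1.
have gf x : g (f x) = 0 by apply/fgE; exists x.
have tq0_surj := tens_map_surj (M := M) q0_surj.
have a0E := alpha_ind_ext mact0; have a1E := alpha_ind_ext mact1.
have [g' g'E] : exists g' : {linear A0 -> A1},
    forall x, g' (q0 x) = (q1 \o restr_map g) x.
  apply: factor_surj => // x /jq0E[t <-]; have [s <-] := tq0_surj t.
  by rewrite /= -a0E -restr_map_alpha a1E (short_exact_comp0 _ jq1).
have gj0 t : restr_map g (j0 t) = j1 (tens_map M g' t).
  have [s <-] := tq0_surj t.
  rewrite /= -a0E -restr_map_alpha a1E /= !tens_map_comp; congr (j1 _).
  by apply: eq_tens_map => x; rewrite /= g'E.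
have g'_surj : surjective g'.
  move=> a; have [x1 <-] := q1_surj a; have [x0 <-] := g_surj x1.
  by exists (q0 x0); rewrite g'E.
pose i : {linear ker g' -> A0} := (\val : ker g' -> A0).
have ig' : short_exact i g' := ker_short_exact g'_surj.
have ti_inj := torA1 _ _ _ _ ig'.
have tig'E : exact (tens_map M i) (tens_map M g').
  by have [_ ? _] := ig'; apply: tens_right_exact.
exists (ker g'), i, g'; split=> //.
have [q qE] : exists q : {linear restr X -> ker g'},
    forall x, i (q x) = (q0 \o restr_map f) x.
  apply: factor_inj => [|x]; first by case: ig'.
  have g'x : g' (q0 (restr_map f x)) = 0.
    by rewrite g'E /= -[restr_map g _]/(g (f x)) gf; apply: raddf0.
  by exists (to_ker g'x).
have [j jE] : exists j : {linear tens M (ker g') -> restr X},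
    forall t, restr_map f (j t) = (j0 \o tens_map M i) t.
  apply: factor_inj => [|t]; first exact: f_inj.
  apply/fgE; rewrite -[g _]/(restr_map g _) gj0.
  have -> : tens_map M g' (tens_map M i t) = 0 by apply/tig'E; exists t.
  exact: raddf0.
exists j, q; split=> [|m x]; last first.
  have jm : restr_map f (j (tensor m (q x))) = j0 (tensor m (q0 (restr_map f x))).
    by rewrite jE /= tens_mapE [X in tensor m X]qE.
  apply: f_inj.
  exact: etrans (restr_map_mact f m x) (etrans (mact0 _ _) (esym jm)).
split=> [|x|k].
- by move=> s t st; apply: ti_inj; apply: j0_inj; rewrite -![j0 _]jE st.
- split=> [qx|[t <-]].
    have /jq0E[t0 t0E] : q0 (restr_map f x) = 0 by rewrite -[LHS]qE qx raddf0.
    have /tig'E[t tE] : tens_map M g' t0 = 0.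
      by apply: j1_inj; rewrite -gj0 t0E linear0; apply: gf.
    by exists t; apply: f_inj; apply: etrans (jE t) _; rewrite /= tE.
  apply: val_inj; apply: etrans (qE _) (etrans (congr1 q0 (jE t)) _).
  exact: short_exact_comp0 jq0.
- have [x0 q0x0] := q0_surj (i k).
  have /jq1E[t1 t1E] : q1 (restr_map g x0) = 0.
    by rewrite -[LHS]g'E q0x0; apply: (kerP k).
  have [t0 t0E] := tens_map_surj (M := M) g'_surj t1.
  have gE : g (x0 - j0 t0 : X0) = 0.
    apply/eqP; rewrite raddfB subr_eq0; apply/eqP.
    by apply: etrans _ (esym (gj0 t0)); rewrite t0E t1E.
  have [x fx] := (fgE _).1 gE; exists x; apply: val_inj.
  apply: etrans (qE x) (etrans (congr1 q0 fx) _).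
  by rewrite [LHS]raddfB /= (short_exact_comp0 _ jq0) subr0.
Qed.

(** Taking cokernels of structure maps turns a B^C-coresolution into a
    C-coresolution. *)
Lemma ind_ext_cores_dim (C : modclass R) n :
  (forall m A, cores_dim C m A -> (m < n)%N -> tor1 M A) ->
  forall m X, cores_dim (frakB M C) m X -> (m <= n)%N ->
  exists A, cores_dim C m A /\ ind_ext A X.
Proof.
move=> torM m X CX; elim: CX => {m X} [m X /frakBP[A [CA AX]] _|].
  by exists A; split=> //; apply: CoresDim0.
move=> m X X0 X1 f g fg /frakBP[B [CB BX0]] _ IH lt_mn.
have [A1 [CA1 AX1]] := IH (ltnW lt_mn).
have [A [i [g' [ig' AX]]]] := ind_ext_sub fg (torM _ _ CA1 lt_mn) BX0 AX1.
by exists A; split=> //; apply: CoresDimS ig' CB CA1.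
Qed.

(** An R-linear section A -> X corresponds by adjunction to an S-linear map
    [ind A] -> X, which is the identity on M (x) A and on A. *)
Lemma ind_ext_iso A X : ind_ext A X -> ext1 A (tens M A) ->
  exists v : {linear ind M A -> X}, bijective v.
Proof.
move=> [j [q [jq mactE]]] extA; have [s qs] := ext1_section extA jq.
have [j_inj jqE q_surj] := jq.
have [v vE] := ind_lift s; exists v.
have vE' (y : A * tens M A) : v y = (s y.1 + j y.2 : restr X).
  rewrite vE (alpha_ind_ext mactE) tens_map_comp tens_map_id //.
have v_inj : injective v.
  apply: raddf_inj => -[a t]; rewrite /= vE' /= => e.
  have a0 : a = 0.
    by have := congr1 q e; rewrite raddfD /= qs (short_exact_comp0 _ jq) addr0 raddf0.
  move: e; rewrite a0 raddf0 add0r -[X in _ = X](raddf0 j) => /j_inj ->.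
  by [].
have /choice[w wK] : forall x, exists y, v y = x.
  move=> x; have /jqE[t tE] : q (x - s (q x)) = 0 by rewrite raddfB /= qs subrr.
  by exists (q x, t); rewrite vE' /= tE addrC subrK.
by exists w => // y; apply: v_inj; rewrite wK.
Qed.

Lemma ind_short_exact A B F (f : {linear A -> B}) (g : {linear B -> F}) :
  tor1 M F -> short_exact f g ->
  exists (f' : {linear ind M A -> ind M B}) (g' : {linear ind M B -> ind M F}),
    [/\ short_exact f' g',
        forall y : A * tens M A, f' y = (f y.1, tens_map M f y.2)
      & forall y : B * tens M B, g' y = (g y.1, tens_map M g y.2)].
Proof.
move=> torF fg; have [f_inj fgE g_surj] := fg.
have [tf_inj tfgE tg_surj] := tens_short_exact torF fg.
have [f' f'E] := ind_map M f; have [g' g'E] := ind_map M g.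
exists f', g'; split=> //; split=> [x y|[b t]|[c t]].
- by rewrite !f'E => -[/f_inj e1 /tf_inj e2]; apply: injective_projections.
- rewrite g'E /=; split=> [[/fgE[a fa] /tfgE[s ts]]|[[a s]]].
    by exists (a, s); rewrite f'E /= fa ts.
  rewrite f'E /= => -[<- <-]; apply: injective_projections => /=.
    exact: short_exact_comp0 fg.
  by apply/tfgE; exists s.
- have [b gb] := g_surj c; have [s ts] := tg_surj t.
  by exists (b, s); rewrite g'E /= gb ts.
Qed.

Lemma ind_cores_dim (C : modclass R) n :
  (forall m A, cores_dim C m A -> (m < n)%N -> tor1 M A) ->
  forall m A, cores_dim C m A -> (m <= n)%N -> cores_dim (frakB M C) m (ind M A).
Proof.
move=> torM m A CA; elim: CA => {m A} [m A CA|m A B K f g fg CB CK IH] lt_mn.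
  by apply: CoresDim0; apply/frakBP; exists A; split=> //; apply: ind_ext_ind.
have [f' [g' [fg' _ _]]] := ind_short_exact (torM _ _ CK lt_mn) fg.
apply: CoresDimS fg' _ (IH (ltnW lt_mn)).
by apply/frakBP; exists B; split=> //; apply: ind_ext_ind.
Qed.

Lemma ind_projective P : projective P -> projective (ind M P).
Proof.
move=> P_proj X Y g f g_surj.
have [h hE] := P_proj _ _ (restr_map g) (restr_map f \o ind_inl M P) g_surj.
have [v vE] := ind_lift h; exists v => y.
apply: (ind_linear_eq (v := g \o v) (w := f)) => a.
rewrite -[RHS]hE; congr (restr_map g _).
by rewrite [LHS]vE /= !raddf0; apply: addr0.
Qed.

(** By adjunction, an S-linear section over [ind A] amounts to an R-linear lift
    of the inclusion of A. *)
Lemma ext1_ind A Y : ext1 A (restr Y) -> ext1 (ind M A) Y.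
Proof.
move=> extA; apply: ext1_of_sections => E f g fg.
have rfg : short_exact (restr_map f : {linear restr Y -> restr E})
  (restr_map g : {linear restr E -> restr (ind M A)}) by [].
have [s sE] := ext1_lift (ind_inl M A) extA rfg.
have [v vE] := ind_lift s; exists v => y.
apply: (ind_linear_eq (v := g \o v) (w := idfun)) => a.
rewrite -[RHS]sE; congr (restr_map g _).
by rewrite [LHS]vE /= !raddf0; apply: addr0.
Qed.

(** As long as Tor vanishes, [ind] carries syzygies of A over R to syzygies of
    [ind A] over S; it preserves projectives, and for Ext^1 there is
    [ext1_ind]. *)
Lemma Ext_zero_ind i A Y :
  Ext_zero i.+1 A (restr Y) -> (forall j, (j < i)%N -> Tor_zero j.+1 M A) ->
  Ext_zero i.+1 (ind M A) Y.
Proof.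
elim: i A => [|i IHi] A extA torA; first exact/Ext_zero1P/ext1_ind/Ext_zero1P.
have AF := cover_short_exact A; have F_proj := @free_projective R A.
have /Tor_zero1P torA1 := torA 0%N isT.
have [f' [g' [fg' _ _]]] := ind_short_exact torA1 AF.
apply: (Ext_zero_of_presentation fg' (ind_projective F_proj)).
apply: IHi => [|j lt_ji]; first by move/Ext_zero_shift: extA => /(_ _ _ _ _ AF F_proj).
by move/Tor_zero_shift: (torA j.+1 lt_ji) => /(_ _ _ _ _ AF F_proj).
Qed.

End Induced.

(** * Right cotorsion pairs *)

Section RightPair.
Variables (R : pzRingType) (M : bimod R) (n : nat) (C D : modclass R).
Hypotheses (n_ge1 : (1 <= n)%N) (pair : right_cotorsion_pair n C D).
Hypothesis torM : forall (i : nat) (A : lmodType R),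
  (1 <= i <= n)%N -> C A -> Tor_zero i M A.
Hypothesis extTens :
  forall E : lmodType R, vee C n.-1 E -> Ext_zero 1 E (tens M E).
Hypothesis U_cores : coresolving (frakU M D).
Hypothesis B_ext : closed_extensions (vee (frakB M C) n.-1).

Local Notation V := (cores_dim C n.-1).

Fact right_dim_tor1 m A : cores_dim C m A -> (m < n)%N -> tor1 M A.
Proof. exact: tor1_cores_dim. Qed.

(** The approximation of B splits, so B is a direct summand of a module in D.
    Hence membership in D can be tested by Ext^1 alone. *)
Fact right_class_of_ext1 B : (forall A, V A -> ext1 A B) -> D B.
Proof.
move=> extB; have [E [K [f [g [fg DE /veeP VK]]]]] := rcp_approx pair B.
have [p pf] := ext1_retraction (extB K VK) fg.
exact: closed_summands_retracts (rcp_summands pair) _ _ _ _ pf DE.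
Qed.

(** [ind (A * B)] is an extension of [ind B] by [ind A], hence of finite
    B^C-codimension, and its cokernel of the structure map is [A * B]. *)
Fact right_dim_prod A B : V A -> V B -> V (A * B)%type.
Proof.
move=> VA VB; have lt_n : (n.-1 < n)%N by rewrite ltn_predL.
have lr : short_exact (inl_lin A B) (snd : (A * B)%type -> B).
  split=> [x y []|[x y]|y] //; last by exists (0, y).
  by split=> [/= ->|[a <-]//]; exists x.
have [f' [g' [fg' _ _]]] := ind_short_exact (right_dim_tor1 VB lt_n) lr.
have B_vee E : V E -> vee (frakB M C) n.-1 (ind M E).
  by move=> VE; apply/veeP; apply: ind_cores_dim right_dim_tor1 _ _ VE (ltnW lt_n).
have /veeP BAB := B_ext fg' (B_vee _ VA) (B_vee _ VB).
have [E [VE EAB]] := ind_ext_cores_dim right_dim_tor1 BAB (ltnW lt_n).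
have [h h_bij] := ind_ext_unique (ind_ext_ind M (A * B)%type) EAB.
exact: cores_dim_iso h_bij VE.
Qed.

(** By [right_class_of_ext1] it suffices that Ext^1(E, M (x) A) = 0 for E of
    finite C-codimension. This is a summand of Ext^1(E x A, M (x) (E x A)). *)
Fact right_class_tens A : V A -> D (tens M A).
Proof.
move=> VA; apply: right_class_of_ext1 => E VE.
have /Ext_zero1P extEA := extTens ((veeP _ _ _).2 (right_dim_prod VE VA)).
pose i := tens_map M (inr_lin E A); pose p := tens_map M (snd : (E * A)%type -> A).
apply: (ext1_retract (i := inl_lin E A) (p := fst) (i' := i) (p' := p)) extEA => //.
by move=> t; rewrite /p /i /= tens_map_comp tens_map_id.
Qed.

Fact right_pair_Ext i (X Y : lmodType (trivext M)) :
  (i < n)%N -> frakB M C X -> frakU M D Y -> Ext_zero i.+1 X Y.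
Proof.
move=> lt_in /frakBP[A [CA AX]] DY.
have /Ext_zero1P extA := extTens ((veeP _ _ _).2 (CoresDim0 n.-1 CA)).
have [v /linear_inverse[w [vK wK]]] := ind_ext_iso AX extA.
apply: (Ext_zero_retract wK); apply: Ext_zero_ind => [|j lt_ji].
  exact: rcp_Ext pair _ _ _ _ CA DY.
by apply: torM CA; rewrite /= (ltn_trans lt_ji).
Qed.

(** The pushout E of [ind D0] along the counit [ind X] -> X has the cokernel
    [ind K0] of X; as an R-module, it is an extension of M (x) K0 by D0. *)
Fact right_pair_approx (X : lmodType (trivext M)) :
  exists (E K : lmodType (trivext M)) (f : {linear X -> E}) (g : {linear E -> K}),
    [/\ short_exact f g, frakU M D E & vee (frakB M C) n.-1 K].
Proof.
have [D0 [K0 [f [g [fg DD0 /veeP VK0]]]]] := rcp_approx pair (restr X).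
have lt_n : (n.-1 < n)%N by rewrite ltn_predL.
have torK0 := right_dim_tor1 VK0 lt_n.
have [f' [g' [fg' f'E g'E]]] := ind_short_exact torK0 fg.
have [eps epsE] := ind_lift (idfun : {linear restr X -> restr X}).
have [E [i [p [v [ip vf' pv]]]]] := pushout eps fg'.
exists E, (ind M K0), i, p; split=> //; last first.
  by apply/veeP; apply: ind_cores_dim right_dim_tor1 _ _ VK0 (ltnW lt_n).
have [D_ext _] := U_cores.
apply: (frakU_extensions D_ext (f := restr_map v \o ind_inl M D0)
  (g := ind_snd M K0 \o restr_map p)) DD0 (right_class_tens VK0).
have [[f_inj fgE g_surj] [i_inj ipE p_surj]] := (fg, ip).
have [[_ tfgE tg_surj] [_ fg'E _]] := (tens_short_exact torK0 fg, fg').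
have v_inl x : v (f x, 0) = i x.
  have -> : (f x, 0) = f' (x, 0) :> (D0 * tens M D0).
    by rewrite f'E /= raddf0.
  by rewrite vf' epsE /= !raddf0 addr0.
split=> [|e|t].
- apply: raddf_inj => d /= vd0.
  have /fgE[x fx] : g d = 0.
    have := pv (d, 0); rewrite [v _]vd0 raddf0 g'E => /(congr1 fst) /= e0.
    exact: esym e0.
  move: vd0; rewrite -fx -[LHS]/(v (f x, 0)) v_inl => ix0.
  by have -> : x = 0; [apply: i_inj; rewrite ix0 raddf0 | rewrite raddf0].
- split=> [/= pe2|[d <-]]; last first.
    by rewrite /= -[restr_map p _]/(p (v (d, 0))) pv g'E /= raddf0.
  (* e - v (d, 0) comes from X, and the image of X in E lies in that of D0 *)
  have [d gd] := g_surj (p e : restr (ind M K0)).1.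
  have peE : p e = p (v (d, 0)).
    rewrite pv g'E; apply: injective_projections; rewrite /= ?gd ?raddf0 //.
  have [x ix] : exists x, i x = e - v (d, 0).
    by apply/ipE; rewrite raddfB /= peE subrr.
  have vD : v (f x + d, 0) = v (f x, 0) + v (d, 0).
    by rewrite -raddfD; congr (v _); apply: injective_projections; rewrite /= ?addr0.
  by exists (f x + d); apply: etrans vD _; rewrite v_inl ix subrK.
- have [s ts] := tg_surj t; exists (v (0, s)).
  by rewrite /= -[restr_map p _]/(p (v (0, s))) pv g'E.
Qed.

Theorem trivext_right_pair : right_cotorsion_pair n (frakB M C) (frakU M D).
Proof.
split.
- exact/frakU_summands/(rcp_summands pair).
- by move=> [|i] X Y // lt_in; apply: right_pair_Ext.
- exact: right_pair_approx.
Qed.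

End RightPair.

Theorem theorem4p4 (R : pzRingType) (M : bimod R) (n : nat) (n_ge1 : (1 <= n)%N)
    (C D : modclass R) :
  (left_cotorsion_pair n C D ->
   (forall (i : nat) (B : lmodType R),
      (1 <= i <= n)%N -> D B -> Ext_zero i M B) ->
   (forall F : lmodType R, wedge D n.-1 F -> Ext_zero 1 (lhom M F) F) ->
   resolving (frakU M C) ->
   closed_extensions (wedge (frakJ M D) n.-1) ->
   left_cotorsion_pair n (frakU M C) (frakJ M D))
  /\
  (right_cotorsion_pair n C D ->
   (forall (i : nat) (A : lmodType R),
      (1 <= i <= n)%N -> C A -> Tor_zero i M A) ->
   (forall E : lmodType R, vee C n.-1 E -> Ext_zero 1 E (tens M E)) ->
   coresolving (frakU M D) ->
   closed_extensions (vee (frakB M C) n.-1) ->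
   right_cotorsion_pair n (frakB M C) (frakU M D)).
Proof. by split=> *; [apply: trivext_left_pair | apply: trivext_right_pair]. Qed.
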